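(* Let $G$ be a finite group and assume that $K$ contains a primitive $|G|$-th root of unity. Let $\chi\in\mathbb{Z}\mathrm{Irr}(G)$. There are $u\in G_p$ and $\varphi\in\mathrm{IBr}(C_G(u))$ such that $c(\chi)_p=c(d^u_{\chi,\varphi})$ and such that $c(\chi)_p\geq c(d^{v}_{\chi,\psi})$ for all $v\in G_p$ and all $\psi\in\mathrm{IBr}(C_G(v))$.
   Context: Let $p$ be a prime, $\mathcal{O}$ a complete discrete valuation ring with residue field $k$ of characteristic $p$ and field of fractions $K$ of characteristic $0$. For a positive integer $n$, $\zeta_n$ denotes a primitive $n$-th root of unity in an extension field of $K$. For a finite group $G$, $\mathrm{Irr}(G)$ is the set of $K$-valued irreducible characters, $\mathrm{IBr}(G)$ the set of $K$-valued irreducible ($p$-)Brauer characters, $\mathbb{Z}\mathrm{Irr}(G)$ the group of generalised characters, and $G_p$, $G_{p'}$ are the sets of elements of order a power of $p$, respectively of order prime to $p$. For $\chi\in\mathbb{Z}\mathrm{Irr}(G)$, $u\in G_p$ and $\varphi\in\mathrm{IBr}(C_G(u))$, the generalised decomposition numbers $d^u_{\chi,\varphi}$ are the unique cyclotomic integers (Brauer) such that $\chi(us)=\sum_{\varphi\in\mathrm{IBr}(C_G(u))} d^u_{\chi,\varphi}\,\varphi(s)$ for all $s\in C_G(u)_{p'}$; they lie in $\mathbb{Q}(\eta)$ for some root of unity $\eta$ of $p$-power order dividing the order of $u$. For a set $S$ of cyclotomic integers, $c(S)$ is the smallest positive integer $n$ with $S\subseteq\mathbb{Q}(\zeta_n)$;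 for a single cyclotomic integer $\sigma$ write $c(\sigma)=c(\{\sigma\})$. For $\chi\in\mathbb{Z}\mathrm{Irr}(G)$ the conductor is $c(\chi)=c(\{\chi(g)\mid g\in G\})$, and $c(\chi)_p$ is the highest power of $p$ dividing $c(\chi)$. *)

(* Defs.v *)
From HB Require Import structures.
From mathcomp Require Import all_boot all_order all_fingroup all_algebra.
From mathcomp Require Import all_solvable all_field all_character.
From mathcomp Require Import boolp classical_sets fsbigop.

Set Implicit Arguments.
Unset Strict Implicit.
Unset Printing Implicit Defensive.

Import Order.TTheory GRing.Theory Num.Theory.
Local Open Scope classical_set_scope.
Local Open Scope ring_scope.

(* The value v 0 is irrelevant: the convention v 0 = +oo is in [val_ge]. *)
Definition discrete_valuation (K : fieldType) (v : K -> int) : Prop :=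
  [/\ exists2 t : K, t != 0 & v t = 1,
      forall x y : K, x != 0 -> y != 0 -> v (x * y) = v x + v y
    & forall x y : K, x != 0 -> y != 0 -> x + y != 0 ->
        Num.min (v x) (v y) <= v (x + y)].

Definition val_ge (K : fieldType) (v : K -> int) (n : int) (x : K) : bool :=
  (x == 0) || (n <= v x).

Definition is_fraction_field (O : idomainType) (K : fieldType)
    (emb : {rmorphism O -> K}) : Prop :=
  injective emb /\
  forall x : K, exists a b : O, b != 0 /\ x = emb a / emb b.

Definition is_valuation_ring (O : idomainType) (K : fieldType)
    (emb : {rmorphism O -> K}) (v : K -> int) : Prop :=
  forall x : K, (exists a : O, x = emb a) <-> val_ge v 0 x.

Definition is_complete (O : idomainType) (K : fieldType)
    (emb : {rmorphism O -> K}) (v : K -> int) : Prop :=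
  forall x : nat -> O,
    (forall N : int, exists m : nat, forall i j : nat,
       (m <= i)%N -> (m <= j)%N -> val_ge v N (emb (x i - x j))) ->
  exists l : O, forall N : int, exists m : nat, forall i : nat,
       (m <= i)%N -> val_ge v N (emb (x i - l)).

(* The kernel of the residue map is the set of non-units, which is the maximal
   ideal when O is local. *)
Definition is_residue_field (O : idomainType) (k : fieldType)
    (res : {rmorphism O -> k}) : Prop :=
  (forall y : k, exists a : O, res a = y) /\
  (forall a : O, (res a == 0) = (a \isn't a GRing.unit)).

Record modular_system (p : nat) := ModularSystem {
  ringO : idomainType;
  fracK : fieldType;
  resk : fieldType;
  emb : {rmorphism ringO -> fracK};
  res : {rmorphism ringO -> resk};
  modular_fraction : is_fraction_field emb;
  modular_dvr : exists v : fracK -> int,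
    [/\ discrete_valuation v, is_valuation_ring emb v & is_complete emb v];
  modular_residue : is_residue_field res;
  modular_pchar_res : p \in [pchar resk];
  modular_pchar_frac : [pchar fracK] =i pred0
}.

(* All class functions, ordinary and Brauer, are finite functions on the whole
   group type, set to 0 outside their domain, so that equality in
   {ffun gT -> K} is equality on the domain. *)

Definition affords (K : fieldType) (gT : finGroupType) (G : {group gT})
    (n : nat) (rG : mx_representation K G n) (chi : {ffun gT -> K}) : Prop :=
  forall g : gT, chi g = if g \in G then \tr (rG g) else 0.

Definition Irr (K : fieldType) (gT : finGroupType) (G : {group gT}) :
    set {ffun gT -> K} :=
  [set chi | exists (n : nat) (rG : mx_representation K G n),
     mx_irreducible rG /\ affords rG chi].

Definition ZIrr (K : fieldType) (gT : finGroupType) (G : {group gT}) :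
    set {ffun gT -> K} :=
  [set chi | exists (n : nat) (c : 'I_n -> int) (psi : 'I_n -> {ffun gT -> K}),
     (forall i : 'I_n, Irr G (psi i)) /\ chi = \sum_(i < n) psi i *~ c i].

(* At a p'-element s of H, the list l consists of the lifts to roots of unity
   of p'-order in O of the eigenvalues of rH s, with multiplicity; these have
   order dividing the order of s. *)
Definition brauer_affords (p : nat) (M : modular_system p)
    (gT : finGroupType) (H : {group gT}) (n : nat)
    (rH : mx_representation (resk M) H n) (phi : {ffun gT -> fracK M}) : Prop :=
  (forall s : gT, s \in H -> (p^'.-elt s)%g ->
     exists l : seq (ringO M),
       [/\ forall a : ringO M, a \in l -> a ^+ #[s]%g = 1,
           char_poly (rH s) = \prod_(a <- l) ('X - (res M a)%:P)
         & phi s = \sum_(a <- l) emb M a]) /\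
  (forall s : gT, ~~ ((s \in H) && (p^'.-elt s)%g) -> phi s = 0).

Definition IBr (p : nat) (M : modular_system p)
    (gT : finGroupType) (H : {group gT}) : set {ffun gT -> fracK M} :=
  [set phi | exists (n : nat) (rH : mx_representation (resk M) H n),
     mx_irreducible rH /\ brauer_affords rH phi].
Arguments IBr {p} M {gT} H.

(* Q(z) = Q[z], as z is algebraic over Q. *)
Definition in_cyclotomic (K : fieldType) (n : nat) (S : set K) : Prop :=
  exists (L : fieldType) (i : {rmorphism K -> L}) (z : L),
    n.-primitive_root z /\
    forall x : K, S x -> exists q : {poly rat}, i x = (map_poly ratr q).[z].

(* The ring of integers of Q(z) is Z[z]. *)
Definition cyclotomic_integer (K : fieldType) (x : K) : Prop :=
  exists (n : nat) (L : fieldType) (i : {rmorphism K -> L}) (z : L)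
         (q : {poly int}),
    n.-primitive_root z /\ i x = (map_poly intr q).[z].

Definition conductor (K : fieldType) (S : set K) : nat :=
  xget 0%N [set n : nat | [/\ (0 < n)%N, in_cyclotomic n S
    & forall m : nat, (0 < m)%N -> in_cyclotomic m S -> (n <= m)%N]].

Definition char_conductor (K : fieldType) (gT : finGroupType) (G : {group gT})
    (chi : {ffun gT -> K}) : nat :=
  conductor [set x : K | exists2 g : gT, g \in G & x = chi g].

(* IBr M 'C_G[u] is a finite set, so the sum is not the default 0 that a
   finitely supported sum takes on infinite supports. *)
Definition is_gen_decomposition (p : nat) (M : modular_system p)
    (gT : finGroupType) (G : {group gT}) (chi : {ffun gT -> fracK M}) (u : gT)
    (d : {ffun gT -> fracK M} -> fracK M) : Prop :=
  (forall phi : {ffun gT -> fracK M}, IBr M 'C_G[u]%G phi ->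
     cyclotomic_integer (d phi)) /\
  forall s : gT, s \in 'C_G[u]%g -> (p^'.-elt s)%g ->
    chi (u * s)%g = \sum_(phi \in IBr M 'C_G[u]%G) d phi * phi s.

(* A function d as above exists and is unique on IBr(C_G(u)) by Brauer, so the
   value below is meaningful for phi in IBr(C_G(u)) and u a p-element. *)
Definition gen_decomposition_number (p : nat) (M : modular_system p)
    (gT : finGroupType) (G : {group gT}) (chi : {ffun gT -> fracK M}) (u : gT)
    (phi : {ffun gT -> fracK M}) : fracK M :=
  xget 0 [set x : fracK M | exists d : {ffun gT -> fracK M} -> fracK M,
    is_gen_decomposition G chi u d /\ x = d phi].

(* Main.v *)
Require Import Defs.
From HB Require Import structures.
From mathcomp Require Import all_boot all_order all_fingroup all_algebra.
From mathcomp Require Import all_solvable all_field all_character.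
From mathcomp Require Import boolp classical_sets fsbigop.
From mathcomp Require Import ring.

Set Implicit Arguments.
Unset Strict Implicit.
Unset Printing Implicit Defensive.

Import GRing.Theory Num.Theory.
Local Open Scope classical_set_scope.
Local Open Scope ring_scope.

(** Write [n = #|G| = m * q], with [q] the [p]-part of [n].

    The generalised decomposition numbers are unique because the irreducible
    Brauer characters of a group [H] are linearly independent ([IBr_free]), and
    exist because of two facts: the eigenspaces of [u] in a representation of [G]
    are representations of its centraliser ([eigen_repr]), and the character of a
    representation over [K] agrees, on [p']-elements, with the sum of the Brauer
    characters of the composition factors of the reduction of a stable lattice
    ([integral_form], [decomposition]). They are thus integral polynomials in a
    [q]-th root of unity, while Brauer characters have their values in
    [Q(zeta_m)].

    An automorphism of [Q(zeta_n)] that is trivial on [Q(zeta_m)] therefore acts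
    on the decomposition of [chi (u * s)] through the coefficients, and fixes
    [chi] if and only if it fixes all the generalised decomposition numbers. It
    follows that, for a divisor [e] of [q], the values of [chi] lie in
    [Q(zeta_(m * e))] if and only if all the generalised decomposition numbers
    lie in [Q(zeta_e)] ([values_cyclotomicP]). As the conductor of a set is
    divisibility-minimal ([conductorP]), the [p]-part of the conductor of [chi] is
    the least such [e]; the conductors of the generalised decomposition numbers
    are powers of [p] dividing [e], and one of them must be [e].

    The linear independence of the Brauer characters is obtained by a count. The
    simple modules in characteristic [p] are separated by elements of the group
    algebra ([separation]), so that the traces of simple submodules of their
    extensions to a splitting field are linearly independent functions on the
    classes of [p']-elements; thus, there are no more simple modules than such
    classes ([leq_irr_preg]). Conversely, the indicator functions of these classes
    are combinations of characters over [K] ([class_indicator_repr]), and hence of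
    irreducible Brauer characters. *)

(** * Cyclotomic fields *)

Lemma pchar0_intr_neq0 (L : fieldType) (m : int) :
  [pchar L] =i pred0 -> m != 0 -> m%:~R != 0 :> L.
Proof.
move=> L0 nz_m; have /pcharf0P L0n := L0.
case: m nz_m => n nz_m; rewrite ?NegzE ?rmorphN ?oppr_eq0 /= -?pmulrn L0n //.
Qed.

Lemma rat_morphism (L : fieldType) :
  [pchar L] =i pred0 -> exists f : {rmorphism rat -> L}, f =1 ratr.
Proof.
move=> L0; pose f (a : rat) : L := ratr a.
have nzd a : (denq a)%:~R != 0 :> L by rewrite pchar0_intr_neq0 ?denq_neq0.
have fE a (m n : int) : n != 0 -> a = m%:~R / n%:~R -> f a = m%:~R / n%:~R.
  move=> nz_n Da; have nzn : n%:~R != 0 :> L by rewrite pchar0_intr_neq0.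
  apply/eqP; rewrite /f /ratr eqr_div // -!rmorphM /=; apply/eqP.
  congr (_%:~R); apply: (@intr_inj rat); rewrite !rmorphM /=.
  apply/eqP; rewrite -eqr_div ?intr_eq0 ?denq_neq0 //.
  by rewrite divq_num_den Da.
have fB : zmod_morphism f.
  move=> a b; pose d := denq a * denq b.
  have nz_d : d != 0 by rewrite mulf_neq0 ?denq_neq0.
  rewrite (@fE _ (numq a * denq b - numq b * denq a) d nz_d).
    by rewrite /f /ratr /d !rmorphB !rmorphM /=; field; rewrite !nzd.
  rewrite -[a in LHS]divq_num_den -[b in LHS]divq_num_den /d !rmorphB !rmorphM /=.
  by field; rewrite !intr_eq0 !denq_neq0.
have fM : monoid_morphism f.
  split=> [|a b]; first by rewrite /f /ratr divr1.
  rewrite (@fE _ (numq a * numq b) (denq a * denq b)) ?mulf_neq0 ?denq_neq0 //.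
    by rewrite /f /ratr !rmorphM /= -mulf_div.
  by rewrite !rmorphM /= -mulf_div !divq_num_den.
pose faM := GRing.isZmodMorphism.Build _ _ f fB.
pose fmM := GRing.isMonoidMorphism.Build _ _ f fM.
pose g : {rmorphism rat -> L} := HB.pack f faM fmM.
by exists g.
Qed.

Lemma root_bigprod (L : idomainType) (I : Type) (r : seq I) (F : I -> {poly L}) z :
  root (\prod_(i <- r) F i) z = has (fun i => root (F i) z) r.
Proof.
elim: r => [|i r IHr]; last by rewrite big_cons rootM IHr.
by rewrite big_nil /root hornerE oner_eq0.
Qed.

(** A primitive [n]-th root of unity is a root of the [n]-th cyclotomic
    polynomial, in every integral domain in which it exists. *)
Lemma root_Cyclotomic (L : idomainType) (n : nat) (z : L) :
  n.-primitive_root z -> root (map_poly intr 'Phi_n) z.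
Proof.
move=> prim_z; have n_gt0 := prim_order_gt0 prim_z.
have: root (map_poly intr ('X^n - 1 : {poly int})) z.
  rewrite rmorphB /= map_polyXn rmorph1 /root !hornerE.
  by rewrite prim_expr_order // subrr.
rewrite -(prod_Cyclotomic n_gt0) rmorph_prod /= root_bigprod.
case/hasP=> d; rewrite -dvdn_divisors // => dv_dn /= root_d.
have d_gt0 := dvdn_gt0 n_gt0 dv_dn.
suffices zd1 : z ^+ d = 1.
  suffices <- : d = n by [].
  by apply/eqP; rewrite eqn_dvd dv_dn (prim_order_dvd prim_z) zd1 eqxx.
have: root (map_poly intr ('X^d - 1 : {poly int})) z.
  rewrite -(prod_Cyclotomic d_gt0) rmorph_prod /= root_bigprod.
  by apply/hasP; exists d; rewrite // -dvdn_divisors.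
rewrite rmorphB /= map_polyXn rmorph1 /root !hornerE.
by rewrite subr_eq0 => /eqP.
Qed.

(** The cyclotomic polynomial divides every rational polynomial that vanishes at
    a primitive [n]-th root of unity of a number field: it is the minimal
    polynomial of the image of this root in the algebraic numbers. *)
Lemma Cyclotomic_dvdp (Qn : fieldExtType rat) (QnC : {rmorphism Qn -> algC})
    (n : nat) (w : Qn) (q : {poly rat}) :
  n.-primitive_root w -> root (map_poly (in_alg Qn) q) w ->
  map_poly intr 'Phi_n %| q.
Proof.
move=> prim_w; rewrite -(fmorph_root QnC) -map_poly_comp.
rewrite (@eq_map_poly _ _ _ ratr) => [|a]; last by rewrite /= alg_num_field fmorph_rat.
have prim_wC : n.-primitive_root (QnC w) by rewrite fmorph_primitive_root.
have [r [Dr _] ->] := minCpolyP (QnC w).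
suffices -> : r = map_poly intr 'Phi_n by [].
apply: (map_poly_inj (ratr : {rmorphism rat -> algC})).
rewrite -Dr (minCpoly_cyclotomic prim_wC) -(Cintr_Cyclotomic prim_wC).
by rewrite -map_poly_comp; apply: eq_map_poly => a /=; rewrite rmorph_int.
Qed.

(** The [n]-th cyclotomic field, given with a primitive [n]-th root of unity;
    the last clause is the irreducibility of the cyclotomic polynomials. *)
Record cyclotomic_field (n : nat) := CyclotomicField {
  cyc_sort :> splittingFieldType rat;
  cyc_gen : cyc_sort;
  cyc_galois : galois 1 {:cyc_sort};
  cyc_genP : n.-primitive_root cyc_gen;
  cyc_full : <<1; cyc_gen>>%VS = fullv;
  cyc_dvdp : forall (d : nat) (w : cyc_sort) (q : {poly rat}),
    d.-primitive_root w -> root (map_poly (in_alg cyc_sort) q) w ->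
    map_poly intr 'Phi_d %| q
}.
Arguments cyc_gen {n} Q : rename.

Lemma cyclotomic_field_exists (n : nat) : (n > 0)%N -> inhabited (cyclotomic_field n).
Proof.
move=> n_gt0; have [Qn galQ [QnC _ [w [prim_w genw] _]]] :=
  group_num_field_exists [group of Zp n].
rewrite /= card_Zp // in prim_w.
by split; exists Qn w => // d v q; apply: Cyclotomic_dvdp QnC _ _ _.
Qed.

Section CyclotomicField.

Variables (n : nat) (Q : cyclotomic_field n).

(** A primitive [d]-th root of unity and the subfield that it generates, for
    [d] a divisor of [n]; they are meaningless for other values of [d]. *)
Definition cyc_root (d : nat) : Q := cyc_gen Q ^+ (n %/ d).
Definition cyc_sub (d : nat) : {subfield Q} := <<1; cyc_root d>>%AS.

Lemma cyc_gt0 : (n > 0)%N.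
Proof. exact: prim_order_gt0 (cyc_genP Q). Qed.

Lemma cyc_rootP (d : nat) : (d %| n)%N -> d.-primitive_root (cyc_root d).
Proof. by move=> dv_dn; apply: dvdn_prim_root dv_dn; apply: cyc_genP. Qed.

Lemma cyc_root_full : cyc_root n = cyc_gen Q.
Proof. by rewrite /cyc_root divnn cyc_gt0 expr1. Qed.

Lemma cyc_subP (d : nat) (x : Q) :
  reflect (exists q : {poly rat}, x = (map_poly (in_alg Q) q).[cyc_root d])
          (x \in cyc_sub d).
Proof. exact: Fadjoin1_polyP. Qed.

Lemma cyc_sub_full (x : Q) : x \in cyc_sub n.
Proof. by rewrite /cyc_sub cyc_root_full /= cyc_full memvf. Qed.

Lemma cyc_root_in (d : nat) (x : Q) : (d %| n)%N -> x ^+ d = 1 -> x \in cyc_sub d.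
Proof.
move=> dv_dn /(prim_rootP (cyc_rootP dv_dn))[i ->].
by rewrite rpredX // memv_adjoin.
Qed.

Lemma cyc_subS (d e : nat) : (d %| e)%N -> (e %| n)%N -> (cyc_sub d <= cyc_sub e)%VS.
Proof.
move=> dv_de dv_en; apply/FadjoinP; split; first exact: sub1v.
apply: cyc_root_in => //; apply/eqP.
by rewrite -(prim_order_dvd (cyc_rootP (dvdn_trans dv_de dv_en))).
Qed.

Lemma dim_cyc_sub (d : nat) : (d %| n)%N -> \dim (cyc_sub d) = totient d.
Proof.
move=> dv_dn; have prim_d := cyc_rootP dv_dn.
rewrite dim_Fadjoin dimv1 muln1; apply: succn_inj.
rewrite -[LHS](size_minPoly 1 (cyc_root d)).
have [p Dp] := polyOver1P (minPolyOver 1 (cyc_root d)).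
have root_p : root (map_poly (in_alg Q) p) (cyc_root d) by rewrite -Dp root_minPoly.
have dvdPp := cyc_dvdp prim_d root_p.
have sizeP : size (map_poly intr 'Phi_d : {poly rat}) = (totient d).+1.
  by rewrite size_map_inj_poly ?size_Cyclotomic //; apply: intr_inj.
apply/eqP; rewrite eqn_leq -{2}sizeP; apply/andP; split; last first.
  rewrite Dp size_map_poly dvdp_leq //.
  by rewrite -(map_poly_eq0 (in_alg Q)) -Dp monic_neq0 ?monic_minPoly.
rewrite -sizeP -(size_map_poly (in_alg Q)); apply: dvdp_leq.
  by rewrite map_poly_eq0 -size_poly_eq0 sizeP.
apply: minPoly_dvdp; first by apply/polyOver1P; exists (map_poly intr 'Phi_d).
rewrite -map_poly_comp (@eq_map_poly _ _ _ intr) ?root_Cyclotomic //.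
by move=> a; apply: (rmorph_int (in_alg Q)).
Qed.

Lemma totient_gcd_lcm (a b : nat) : (a > 0)%N -> (b > 0)%N ->
  (totient (gcdn a b) * totient (lcmn a b) = totient a * totient b)%N.
Proof.
(* On the primes in [pi], [a] is the lcm and [b] is the gcd; on the other primes
   it is the other way round. *)
move=> a_gt0 b_gt0; pose pi : nat_pred := [pred p | (logn p b <= logn p a)%N].
have split_tot c : (c > 0)%N -> totient c = (totient c`_pi * totient c`_pi^')%N.
  by move=> c_gt0; rewrite -totient_coprime ?coprime_partC // partnC.
have g_gt0 : (gcdn a b > 0)%N by rewrite gcdn_gt0 a_gt0.
have l_gt0 : (lcmn a b > 0)%N by rewrite lcmn_gt0 a_gt0.
have partE (c d : nat) (rho : nat_pred) : (c > 0)%N -> (d > 0)%N ->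
    (forall p, p \in rho -> logn p c = logn p d) -> (c`_rho = d`_rho)%N.
  by move=> c_gt0 d_gt0 Ecd; apply: eq_partn_from_log.
rewrite (split_tot a) // (split_tot b) // (split_tot _ g_gt0) (split_tot _ l_gt0).
rewrite (@partE (gcdn a b) b pi) ?(@partE (lcmn a b) a pi) //; first last.
- by move=> p; rewrite inE => le_ba; rewrite logn_gcd //; apply/minn_idPr.
- by move=> p; rewrite inE => le_ba; rewrite logn_lcm //; apply/maxn_idPl.
rewrite (@partE (gcdn a b) a pi^') ?(@partE (lcmn a b) b pi^') //; first last.
- move=> p; rewrite !inE -ltnNge => /ltnW le_ab.
  by rewrite logn_gcd //; apply/minn_idPl.
- move=> p; rewrite !inE -ltnNge => /ltnW le_ab.
  by rewrite logn_lcm //; apply/maxn_idPr.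
by ring.
Qed.

Lemma divn_lcm_gcd (m a b : nat) : (m > 0)%N -> (a %| m)%N -> (b %| m)%N ->
  (m %/ lcmn a b = gcdn (m %/ a) (m %/ b))%N.
Proof.
move=> m_gt0 dv_am dv_bm; have a_gt0 := dvdn_gt0 m_gt0 dv_am.
have b_gt0 := dvdn_gt0 m_gt0 dv_bm.
have dv_lm : (lcmn a b %| m)%N by rewrite dvdn_lcm dv_am.
have g_gt0 : (gcdn a b > 0)%N by rewrite gcdn_gt0 a_gt0.
have l_gt0 : (lcmn a b > 0)%N by rewrite lcmn_gt0 a_gt0.
apply/eqP; rewrite -(eqn_pmul2r l_gt0) divnK //.
rewrite -(eqn_pmul2r g_gt0) -mulnA muln_lcm_gcd.
have [a' Da] := dvdnP dv_am; have [b' Db] := dvdnP dv_bm.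
have -> : (m %/ a = a')%N by rewrite Da mulnK.
have -> : (m %/ b = b')%N by rewrite Db mulnK.
rewrite [X in _ == X]mulnC !muln_gcdr gcdnC; apply/eqP.
by congr gcdn; [rewrite Da | rewrite Db]; ring.
Qed.

(** Intersections of cyclotomic fields are computed by a count of degrees:
    with [F] the intersection, the minimal polynomial of [zeta_a] over
    [Q(zeta_b)] divides the one over [F], so that the degree of the compositum
    [Q(zeta_(lcm a b))] times that of [F] is at most [totient a * totient b]. *)
Lemma cyc_sub_cap (a b : nat) (x : Q) : (a %| n)%N -> (b %| n)%N ->
  x \in cyc_sub a -> x \in cyc_sub b -> x \in cyc_sub (gcdn a b).
Proof.
move=> dv_an dv_bn xa xb; set g := gcdn a b.
have n_gt0 := cyc_gt0; have a_gt0 := dvdn_gt0 n_gt0 dv_an.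
have b_gt0 := dvdn_gt0 n_gt0 dv_bn.
have dv_gn : (g %| n)%N := dvdn_trans (dvdn_gcdl a b) dv_an.
have dv_ln : (lcmn a b %| n)%N by rewrite dvdn_lcm dv_an.
pose F := (cyc_sub a :&: cyc_sub b)%AS.
have sFa : (F <= cyc_sub a)%VS by rewrite capvSl.
have sFb : (F <= cyc_sub b)%VS by rewrite capvSr.
have sgF : (cyc_sub g <= F)%VS.
  by rewrite subv_cap !cyc_subS ?dvdn_gcdl ?dvdn_gcdr.
suffices /eqP -> : cyc_sub g == F :> {vspace Q} by rewrite memv_cap xa.
rewrite eqEdim sgF [X in (_ <= X)%N]dim_cyc_sub //.
have aF : <<F; cyc_root a>>%AS = cyc_sub a :> {vspace Q}.
  apply/eqP; rewrite eqEsubv; apply/andP; split; apply/FadjoinP; split => //.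
  - exact: memv_adjoin.
  - exact: sub1v.
  - exact: memv_adjoin.
(* By Bezout, a primitive root of order [lcmn a b] is a quotient of powers of
   the primitive roots of orders [a] and [b]. *)
have slab : (cyc_sub (lcmn a b) <= <<cyc_sub b; cyc_root a>>)%VS.
  apply/FadjoinP; split; first exact: sub1v.
  have wa : cyc_root a \in <<cyc_sub b; cyc_root a>>%VS by exact: memv_adjoin.
  have wb : cyc_root b \in <<cyc_sub b; cyc_root a>>%VS.
    by rewrite (subvP (subv_adjoin _ _)) // memv_adjoin.
  have na_gt0 : (n %/ a > 0)%N by rewrite divn_gt0 // dvdn_leq.
  have [u v Duv _] := egcdnP (n %/ b) na_gt0.
  have -> : (cyc_root (lcmn a b) = cyc_root a ^+ u / cyc_root b ^+ v).
    rewrite /cyc_root -!exprM ![(n %/ _ * _)%N]mulnC Duv exprD.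
    rewrite mulrAC divff ?mul1r.
      by rewrite divn_lcm_gcd.
    by rewrite expf_neq0 // (prim_root_eq0 (cyc_genP Q)) -lt0n.
  by apply: rpred_div; apply: rpredX.
have le_deg : (adjoin_degree (cyc_sub b) (cyc_root a) <= adjoin_degree F (cyc_root a))%N.
  rewrite -ltnS -!size_minPoly dvdp_leq ?monic_neq0 ?monic_minPoly //.
  exact: minPolyS.
have le_l : (totient (lcmn a b) <= adjoin_degree (cyc_sub b) (cyc_root a) * totient b)%N.
  by rewrite -(dim_cyc_sub dv_ln) -(dim_cyc_sub dv_bn) -dim_Fadjoin dimvS.
have Da : (totient a = adjoin_degree F (cyc_root a) * \dim F)%N.
  by rewrite -(dim_cyc_sub dv_an) -dim_Fadjoin aF.
rewrite -(leq_pmul2l (_ : 0 < totient (lcmn a b))%N) ?totient_gt0 ?lcmn_gt0 ?a_gt0 //.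
rewrite [X in (_ <= X)%N]mulnC totient_gcd_lcm // Da.
rewrite (leq_trans (leq_mul le_l (leqnn _))) //.
by rewrite mulnAC; apply: leq_mul => //; apply: leq_mul.
Qed.

End CyclotomicField.

(** * Embeddings of cyclotomic fields, and conductors of sets *)

Lemma map_poly_ratrE (L L' : fieldType) (i : {rmorphism L -> L'}) (q : {poly rat}) x :
  i (map_poly ratr q).[x] = (map_poly ratr q).[i x].
Proof.
rewrite -horner_map -map_poly_comp; congr _.[_].
by apply: eq_map_poly => a /=; rewrite fmorph_rat.
Qed.

Lemma in_algQE (n : nat) (Q : cyclotomic_field n) : in_alg Q =1 ratr.
Proof. by move=> a; rewrite /= alg_num_field. Qed.

Lemma cyc_sub_ratrP (n : nat) (Q : cyclotomic_field n) (d : nat) (x : Q) :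
  x \in cyc_sub Q d <->
  exists q : {poly rat}, x = (map_poly ratr q).[cyc_root Q d].
Proof.
split=> [/cyc_subP | ] [q ->]; last first.
  by apply/cyc_subP; exists q; rewrite (eq_map_poly (@in_algQE n Q)).
by exists q; rewrite (eq_map_poly (@in_algQE n Q)).
Qed.

(** The [n]-th cyclotomic field embeds in every field of characteristic [0] that
    contains a primitive [n]-th root of unity [z]. *)
Lemma cyclotomic_embedding (n : nat) (Q : cyclotomic_field n) (L : fieldType) (z : L) :
  [pchar L] =i pred0 -> n.-primitive_root z ->
  exists h : {rmorphism Q -> L}, h (cyc_gen Q) = z.
Proof.
move=> L0 prim_z; have [f fE] := rat_morphism L0.
have repr (x : Q) : exists q : {poly rat}, x = (map_poly (in_alg Q) q).[cyc_gen Q].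
  by rewrite -cyc_root_full; apply/cyc_subP/cyc_sub_full.
(* The embedding maps [q(w)] to [q(z)]; this is well defined, since a rational
   polynomial that vanishes at [w] is a multiple of the cyclotomic polynomial. *)
pose q_ x := sval (cid (repr x)).
have q_E x : x = (map_poly (in_alg Q) (q_ x)).[cyc_gen Q] by rewrite /q_; case: cid.
pose h x := (map_poly f (q_ x)).[z].
have hE q : h (map_poly (in_alg Q) q).[cyc_gen Q] = (map_poly f q).[z].
  set x := _.[_]; apply/eqP; rewrite -subr_eq0 -hornerN -hornerD -!rmorphN -rmorphD /=.
  have root_w : root (map_poly (in_alg Q) (q_ x - q)) (cyc_gen Q).
    by rewrite rmorphB /root /= !hornerE -q_E subrr.
  have /dvdpP[r ->] := cyc_dvdp (cyc_genP Q) root_w.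
  rewrite rmorphM /= hornerM -map_poly_comp (@eq_map_poly _ _ _ intr).
    by have /rootP -> := root_Cyclotomic prim_z; rewrite mulr0.
  by move=> a /=; rewrite rmorph_int.
have hB : zmod_morphism h.
  move=> x y; rewrite {1}[x]q_E {1}[y]q_E -hornerN -hornerD -rmorphN -rmorphD /= hE.
  by rewrite rmorphB /= !hornerE.
have hM : monoid_morphism h.
  split=> [|x y].
    have -> : 1 = (map_poly (in_alg Q) 1).[cyc_gen Q] by rewrite rmorph1 hornerC.
    by rewrite hE rmorph1 hornerC.
  by rewrite {1}[x]q_E {1}[y]q_E -hornerM -rmorphM /= hE rmorphM /= hornerM.
pose haM := GRing.isZmodMorphism.Build _ _ h hB.
pose hmM := GRing.isMonoidMorphism.Build _ _ h hM.
pose g : {rmorphism Q -> L} := HB.pack h haM hmM.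
exists g; rewrite /g /=.
have -> : cyc_gen Q = (map_poly (in_alg Q) 'X).[cyc_gen Q] by rewrite map_polyX hornerX.
by rewrite hE map_polyX hornerX.
Qed.

(** The product of suitable powers of roots of unity of orders [a] and [b] has
    order [lcmn a b]. *)
Lemma prim_root_lcm (L : fieldType) (a b : nat) (x y : L) :
  a.-primitive_root x -> b.-primitive_root y ->
  exists z : L, (lcmn a b).-primitive_root z.
Proof.
move=> prim_x prim_y; have a_gt0 := prim_order_gt0 prim_x.
have b_gt0 := prim_order_gt0 prim_y.
pose pi : nat_pred := [pred p | (logn p b <= logn p a)%N].
have dv_a : (a`_pi %| a)%N := dvdn_part pi a.
have dv_b : (b`_pi^' %| b)%N := dvdn_part pi^' b.
have l_gt0 : (lcmn a b > 0)%N by rewrite lcmn_gt0 a_gt0.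
have Dl : (lcmn a b = a`_pi * b`_pi^')%N.
  rewrite -(partnC pi l_gt0); congr (_ * _)%N; apply: eq_partn_from_log => // q.
    by rewrite inE => le_ba; rewrite logn_lcm //; apply/maxn_idPl.
  by rewrite !inE -ltnNge => /ltnW le_ab; rewrite logn_lcm //; apply/maxn_idPr.
have co_ab : coprime a`_pi b`_pi^' by rewrite coprime_partC.
pose u := x ^+ (a %/ a`_pi); pose v := y ^+ (b %/ b`_pi^').
have prim_u : (a`_pi).-primitive_root u := dvdn_prim_root prim_x dv_a.
have prim_v : (b`_pi^').-primitive_root v := dvdn_prim_root prim_y dv_b.
have uv1 : (u * v) ^+ lcmn a b = 1.
  rewrite exprMn Dl exprM (prim_expr_order prim_u) expr1n mul1r mulnC.
  by rewrite exprM (prim_expr_order prim_v) expr1n.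
have [m prim_m dv_ml] := prim_order_exists l_gt0 uv1.
exists (u * v); suffices <- : m = lcmn a b by [].
apply/eqP; rewrite eqn_dvd dv_ml Dl Gauss_dvd //=.
have uvm1 : u ^+ m * v ^+ m = 1 by rewrite -exprMn prim_expr_order.
apply/andP; split.
  rewrite -(Gauss_dvdl _ co_ab) (prim_order_dvd prim_u) exprM.
  have := congr1 (fun t => t ^+ b`_pi^') uvm1.
  by rewrite exprMn -[v ^+ m ^+ _]exprM mulnC [v ^+ _]exprM (prim_expr_order prim_v) !expr1n mulr1 => ->.
rewrite coprime_sym in co_ab.
rewrite -(Gauss_dvdl _ co_ab) (prim_order_dvd prim_v) exprM.
have := congr1 (fun t => t ^+ a`_pi) uvm1.
by rewrite exprMn -[u ^+ m ^+ _]exprM mulnC [u ^+ _]exprM (prim_expr_order prim_u) !expr1n mul1r => ->.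
Qed.

Lemma fmorph_pchar0 (K L : fieldType) (i : {rmorphism K -> L}) :
  [pchar K] =i pred0 -> [pchar L] =i pred0.
Proof. by move=> K0 q; rewrite -K0 (fmorph_pchar i). Qed.

Lemma horner_poly_expr (L : fieldType) (q : {poly rat}) (z t : L) (j : nat) :
  [pchar L] =i pred0 -> z = t ^+ j ->
  (map_poly ratr q).[z] = (map_poly ratr (q \Po 'X^j)).[t].
Proof.
move=> L0 ->; have [f fE] := rat_morphism L0.
rewrite -!(eq_map_poly fE) map_comp_poly /= map_polyXn.
by rewrite horner_comp hornerXn.
Qed.

Lemma in_cyclotomic_gt0 (K : fieldType) (n : nat) (S : set K) :
  in_cyclotomic n S -> (n > 0)%N.
Proof. by case=> L [i [z [/prim_order_gt0 ? _]]]. Qed.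

(** The field [Q(zeta_n)] of the definition of [in_cyclotomic] can be realised
    inside [K] as soon as [K] contains a primitive [N]-th root of unity, [n]
    dividing [N]. *)
Lemma in_cyclotomicP (K : fieldType) (N : nat) (Q : cyclotomic_field N)
    (h : {rmorphism Q -> K}) (n : nat) (S : set K) :
  [pchar K] =i pred0 -> (n %| N)%N ->
  in_cyclotomic n S <-> (forall x, S x -> exists2 y, y \in cyc_sub Q n & x = h y).
Proof.
move=> K0 dv_nN; split=> [[L [i [z [prim_z zS]]]] x Sx | hS]; last first.
  exists K, idfun, (h (cyc_root Q n)); split.
    by rewrite fmorph_primitive_root cyc_rootP.
  move=> x /hS[y /cyc_sub_ratrP[q ->] ->]; exists q.
  by rewrite /= map_poly_ratrE.
have L0 := fmorph_pchar0 i K0.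
have prim_i : n.-primitive_root (i (h (cyc_root Q n))).
  by rewrite !fmorph_primitive_root cyc_rootP.
have /(prim_rootP prim_i)[j Dz] := prim_expr_order prim_z.
have [q Dix] := zS x Sx; exists (map_poly ratr (q \Po 'X^j)).[cyc_root Q n].
  by apply/cyc_sub_ratrP; exists (q \Po 'X^j).
apply: (fmorph_inj i); rewrite Dix (horner_poly_expr q L0 Dz).
by rewrite !map_poly_ratrE.
Qed.

Lemma in_cyclotomicS (K : fieldType) (N d e : nat) (S : set K) (zeta : K) :
  [pchar K] =i pred0 -> N.-primitive_root zeta -> (d %| e)%N -> (e %| N)%N ->
  in_cyclotomic d S -> in_cyclotomic e S.
Proof.
move=> K0 prim_zeta dv_de dv_eN; have [Q] := cyclotomic_field_exists (prim_order_gt0 prim_zeta).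
have [h _] := cyclotomic_embedding Q K0 prim_zeta; have dv_dN := dvdn_trans dv_de dv_eN.
move/(in_cyclotomicP h _ K0 dv_dN) => dS; apply/(in_cyclotomicP h _ K0 dv_eN) => x /dS[y dy Dx].
by exists y => //; apply: subvP dy; apply: cyc_subS.
Qed.

(** Both [Q(zeta_m)] and [Q(zeta_N)] are subfields of [Q(zeta_(lcmn m N))], where
    their intersection is given by [cyc_sub_cap]. *)
Lemma in_cyclotomic_gcd (K : fieldType) (N m : nat) (S : set K) (zeta : K) :
  [pchar K] =i pred0 -> N.-primitive_root zeta ->
  in_cyclotomic N S -> in_cyclotomic m S -> in_cyclotomic (gcdn m N) S.
Proof.
move=> K0 prim_zeta NS mS; have N_gt0 := prim_order_gt0 prim_zeta.
have [QN] := cyclotomic_field_exists N_gt0.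
have [hN _] := cyclotomic_embedding QN K0 prim_zeta.
have [L [i [z [prim_z zS]]]] := mS; have m_gt0 := prim_order_gt0 prim_z.
have L0 := fmorph_pchar0 i K0; have l_gt0 : (lcmn m N > 0)%N by rewrite lcmn_gt0 m_gt0.
have prim_i : N.-primitive_root (i zeta) by rewrite fmorph_primitive_root.
have [t prim_t] := prim_root_lcm prim_z prim_i.
have [Q] := cyclotomic_field_exists l_gt0.
have [h _] := cyclotomic_embedding Q L0 prim_t.
have dv_m : (m %| lcmn m N)%N := dvdn_lcml m N.
have dv_N : (N %| lcmn m N)%N := dvdn_lcmr m N.
pose iS : set L := [set i x | x in S].
have miS : in_cyclotomic m iS.
  by exists L, idfun, z; split=> // _ [x Sx <-]; apply: zS.
have NiS : in_cyclotomic N iS.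
  exists L, idfun, (i (hN (cyc_root QN N))); split.
    by rewrite !fmorph_primitive_root cyc_rootP.
  move=> _ [x Sx <-].
  have [y /cyc_sub_ratrP[q ->] ->] := proj1 (in_cyclotomicP hN S K0 (dvdnn N)) NS x Sx.
  by exists q; rewrite /= !map_poly_ratrE.
exists L, i, (h (cyc_root Q (gcdn m N))); split.
  by rewrite fmorph_primitive_root cyc_rootP // (dvdn_trans (dvdn_gcdl _ _)).
move=> x Sx; have iSx : iS (i x) by exists x.
have [y1 y1m Dx] := proj1 (in_cyclotomicP h iS L0 dv_m) miS _ iSx.
have [y2 y2N] := proj1 (in_cyclotomicP h iS L0 dv_N) NiS _ iSx.
rewrite Dx => /fmorph_inj Dy; rewrite -{y2}Dy in y2N.
have /cyc_sub_ratrP[q ->] := cyc_sub_cap dv_m dv_N y1m y2N.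
by exists q; rewrite map_poly_ratrE.
Qed.

(** The conductor is not only the least, but a divisor of all the [m] with
    [S] included in [Q(zeta_m)]. *)
Lemma conductorP (K : fieldType) (N : nat) (S : set K) (zeta : K) :
  [pchar K] =i pred0 -> N.-primitive_root zeta -> in_cyclotomic N S ->
  in_cyclotomic (conductor S) S /\
  (forall m, in_cyclotomic m S -> (conductor S %| m)%N).
Proof.
move=> K0 prim_zeta NS; have N_gt0 := prim_order_gt0 prim_zeta.
pose P (n : nat) := `[< (0 < n)%N /\ in_cyclotomic n S >].
have exP : exists n, P n by exists N; apply/asboolP.
have [c /asboolP[c_gt0 cS] min_c] := ex_minnP exP.
have minP m : in_cyclotomic m S -> (c <= m)%N.
  by move=> mS; apply: min_c; apply/asboolP; rewrite (in_cyclotomic_gt0 mS).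
have c_spec : [/\ (0 < c)%N, in_cyclotomic c S
    & forall m : nat, (0 < m)%N -> in_cyclotomic m S -> (c <= m)%N].
  by split=> // m _; apply: minP.
have -> : conductor S = c.
  apply: xget_unique => // d [d_gt0 dS min_d].
  by apply/eqP; rewrite eqn_leq min_d // minP.
split=> // m mS.
have dv_cN : (c %| N)%N.
  apply/gcdn_idPl/eqP; rewrite eqn_leq dvdn_leq ?dvdn_gcdl //=.
  by apply: minP; apply: in_cyclotomic_gcd prim_zeta _ _.
have prim_c := dvdn_prim_root prim_zeta dv_cN.
apply/gcdn_idPr/eqP; rewrite eqn_leq dvdn_leq ?dvdn_gcdr //=.
by apply: minP; apply: in_cyclotomic_gcd prim_c _ _.
Qed.

(** An element of a cyclotomic field that is fixed by all the automorphisms over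
    [Q(zeta_d)] lies in [Q(zeta_d)]. *)
Lemma cyc_sub_fixed (n : nat) (Q : cyclotomic_field n) (d : nat) (x : Q) :
  (forall s : {rmorphism Q -> Q}, {in cyc_sub Q d, forall y, s y = y} -> s x = x) ->
  x \in cyc_sub Q d.
Proof.
move=> fix_x; have galQd : galois (cyc_sub Q d) {:Q}.
  by apply: galoisS (cyc_galois Q); rewrite sub1v subvf.
have /galois_fixedField <- := galQd.
apply/fixedFieldP => [|s sG]; first exact: memvf.
by apply: fix_x => y yd; apply: (fixed_gal (subvf _) sG yd).
Qed.

(** * Matrix representations over a field *)

Section Representations.

Variables (F : fieldType) (gT : finGroupType) (G : {group gT}).

(** Induction on the length of a composition series. *)
Lemma repr_ind (P : forall n, mx_representation F G n -> Prop) :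
  (forall rG : mx_representation F G 0, P 0%N rG) ->
  (forall n (rG : mx_representation F G n), mx_irreducible rG -> P n rG) ->
  (forall n (rG : mx_representation F G n) (U : 'M_n) (modU : mxmodule rG U),
     P _ (submod_repr modU) -> P _ (factmod_repr modU) -> P n rG) ->
  forall n (rG : mx_representation F G n), P n rG.
Proof.
move=> P0 Pirr Pext n; have [m] := ubnP n; elim: m n => // m IHm [|n] // le_nm rG.
have [/Pirr //|redG] := pselect (mx_irreducible rG).
have [U [modU nzU ntU]] : exists U : 'M_n.+1,
    [/\ mxmodule rG U, U != 0 & ~~ row_full U].
  apply: contrapT => noU; apply: redG; apply/mx_irrP; split=> // U modU nzU.
  by apply: contrapT => ntU; apply: noU; exists U; split=> //; apply/negP.
have rU : (0 < \rank U < n.+1)%N.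
  by rewrite lt0n mxrank_eq0 nzU ltn_neqAle ntU rank_leq_col.
case/andP: rU => rU_gt0 rU_lt.
apply: (Pext _ _ _ modU); apply: IHm; first exact: leq_trans rU_lt _.
by rewrite mxrank_coker -ltnS (leq_trans _ le_nm) // ltnS -[X in (_ < X)%N]subn0 ltn_sub2l.
Qed.

Lemma gring_mx_sum n (rG : mx_representation F G n) (u : 'rV[F]_#|G|) :
  gring_mx rG u = \sum_i u 0 i *: rG (enum_val i).
Proof.
rewrite /gring_mx /= mulmx_sum_row linear_sum; apply: eq_bigr => i _.
by rewrite linearZ /= rowK mxvecK.
Qed.

Lemma gring_mx_row1 n (rG : mx_representation F G n) :
  gring_mx rG (gring_row (1%:M : 'M_#|G|)) = 1%:M.
Proof. by rewrite -gring_opE gring_op1. Qed.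

Lemma gring_mx_submod n (rG : mx_representation F G n) (U : 'M_n)
    (modU : mxmodule rG U) (u : 'rV[F]_#|G|) (c : F) :
  gring_mx rG u = c%:M -> gring_mx (submod_repr modU) u = c%:M.
Proof.
move=> Du; rewrite gring_mx_sum.
transitivity (in_submod U (val_submod (1%:M : 'M_(\rank U)) *m gring_mx rG u)).
  rewrite gring_mx_sum mulmx_sumr linear_sum; apply: eq_bigr => i _.
  by rewrite -scalemxAr linearZ.
by rewrite Du mul_mx_scalar linearZ /= val_submodK scalemx1.
Qed.

Lemma gring_mx_factmod n (rG : mx_representation F G n) (U : 'M_n)
    (modU : mxmodule rG U) (u : 'rV[F]_#|G|) m (W : 'M_(m, n)) :
  in_factmod U (W *m gring_mx rG u) =
  in_factmod U W *m gring_mx (factmod_repr modU) u.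
Proof.
rewrite !gring_mx_sum !mulmx_sumr linear_sum; apply: eq_bigr => i _.
by rewrite -!scalemxAr linearZ /= (in_factmodJ modU) ?enum_valP.
Qed.

(** The image of an idempotent endomorphism affords a representation. *)
Lemma idempotent_repr n (rG : mx_representation F G n) (e : 'M_n) :
  e *m e = e -> (forall x, x \in G -> e *m rG x = rG x *m e) ->
  exists m (rho : mx_representation F G m),
    forall x, x \in G -> \tr (rho x) = \tr (e *m rG x).
Proof.
move=> ee cGe.
have [r [L [R [LR RL]]]] : exists r (L : 'M_(n, r)) (R : 'M_(r, n)),
    L *m R = e /\ R *m L = 1%:M.
  have /row_freeP[R' RR'] := row_base_free e; have /row_fullP[L' L'L] := col_base_full e.
  move: (\rank e) (col_base e) (row_base e) (mulmx_base e) R' RR' L' L'L.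
  move=> r L R LR R' RR' L' L'L; exists r, L, R; split=> //.
  transitivity (L' *m (e *m e) *m R'); last by rewrite ee -LR !mulmxA L'L mul1mx.
  by rewrite -LR !mulmxA L'L mul1mx -!mulmxA RR' mulmx1.
have eL : e *m L = L by rewrite -LR -mulmxA RL mulmx1.
have rho_repr : mx_repr G (fun x => R *m rG x *m L).
  split=> [|x y Gx Gy]; first by rewrite repr_mx1 mulmx1.
  rewrite repr_mxM // !mulmxA -(mulmxA _ L R) LR -(mulmxA _ e (rG y)) cGe //.
  by rewrite !mulmxA -(mulmxA _ e L) eL.
exists r, (MxRepresentation rho_repr) => x Gx /=.
by rewrite -mulmxA mxtrace_mulC -mulmxA LR -cGe.
Qed.

(** An endomorphism of finite order [o] of a representation splits it into
    eigenspaces, when the field contains the [o]-th roots of unity. *)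
Lemma eigen_repr n (rG : mx_representation F G n) (A : 'M_n) (o : nat) (xi : F) :
  o.-primitive_root xi -> A ^+ o = 1 ->
  (forall x, x \in G -> A *m rG x = rG x *m A) ->
  exists rho : 'I_o -> {m : nat & mx_representation F G m},
    forall x, x \in G ->
      \tr (A *m rG x) = \sum_(j < o) xi ^+ j * \tr (tagged (rho j) x).
Proof.
move=> prim_xi Ao cGA; have o_gt0 := prim_order_gt0 prim_xi.
have nz_o : o%:R != 0 :> F := prim_root_natf_neq0 prim_xi.
have nz_xi : xi != 0 by rewrite (prim_root_eq0 prim_xi) -lt0n.
(* [e j] is the projection on the eigenspace of [A] for the eigenvalue [xi ^+ j]. *)
pose e (j : 'I_o) : 'M[F]_n := o%:R^-1 *: \sum_(i < o) xi ^- (i * j) *: A ^+ i.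
have expS k : A ^+ k.+1 = A *m A ^+ k by rewrite exprS -mulmxE.
have Ae j : A *m e j = xi ^+ j *: e j.
  rewrite /e -scalemxAr scalerA mulrC -scalerA; congr (_ *: _).
  rewrite mulmx_sumr scaler_sumr.
  pose f k : 'M[F]_n := xi ^+ j *: (xi ^- (k * j) *: A ^+ k).
  have fS k : A *m (xi ^- (k * j) *: A ^+ k) = f k.+1.
    rewrite -scalemxAr -expS /f scalerA; congr (_ *: _).
    by rewrite mulSn exprD invfM mulrA divff ?mul1r ?expf_neq0.
  have fo : f o = f 0%N.
    by rewrite /f mul0n Ao !expr0 exprM (prim_expr_order prim_xi) expr1n.
  rewrite (eq_bigr (fun i : 'I_o => f i.+1)) => [|i _]; last exact: fS.
  rewrite [RHS](eq_bigr (fun i : 'I_o => f i)) //.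
  by case: (o) o_gt0 fo => // m _ fo; rewrite big_ord_recr big_ord_recl /= fo addrC.
have Ake j k : A ^+ k *m e j = xi ^+ (k * j) *: e j.
  elim: k => [|k IHk]; first by rewrite !expr0 mul1mx scale1r.
  by rewrite expS -mulmxA IHk -scalemxAr Ae scalerA -exprD addnC.
have ee j : e j *m e j = e j.
  rewrite {1}/e -scalemxAl mulmx_suml.
  rewrite (eq_bigr (fun=> e j)) => [|i _]; last first.
    by rewrite -scalemxAl Ake scalerA mulVf ?scale1r ?expf_neq0.
  by rewrite sumr_const card_ord -scaler_nat scalerA mulVf ?scale1r.
have sume : \sum_j e j = 1%:M.
  rewrite -scaler_sumr exchange_big /= (bigD1 (Ordinal o_gt0)) //=.
  rewrite [X in _ + X]big1 ?addr0 => [|i nz_i]; last first.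
    rewrite -scaler_suml; apply/eqP; rewrite scaler_eq0; apply/orP; left.
    have xi1 : xi ^- i - 1 != 0.
      rewrite subr_eq0 invr_eq1 -(prim_order_dvd prim_xi); apply: contra nz_i => dv_i.
      by rewrite -val_eqE /= -(modn_small (ltn_ord i)).
    rewrite -(mulrI_eq0 _ (mulfI xi1)).
    rewrite (eq_bigr (fun j : 'I_o => (xi ^- i) ^+ j)) => [|j _]; last first.
      by rewrite exprVn -exprM.
    rewrite -subrX1 exprVn -exprM mulnC exprM (prim_expr_order prim_xi).
    by rewrite expr1n invr1 subrr.
  rewrite (eq_bigr (fun=> 1%:M)) => [|i _]; last by rewrite mul0n !expr0 invr1 scale1r.
  by rewrite sumr_const card_ord -scaler_nat scalerA mulVf ?scale1r.
have cGe j x : x \in G -> e j *m rG x = rG x *m e j.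
  move=> Gx; rewrite /e -scalemxAl -scalemxAr mulmx_suml mulmx_sumr.
  congr (_ *: _); apply: eq_bigr => i _; rewrite -scalemxAl -scalemxAr.
  congr (_ *: _); elim: (nat_of_ord i) => [|k IHk]; first by rewrite mul1mx mulmx1.
  by rewrite expS -mulmxA IHk !mulmxA cGA.
have rho_ex j : exists r : {m : nat & mx_representation F G m},
    forall x, x \in G -> \tr (tagged r x) = \tr (e j *m rG x).
  by have [m [r rP]] := idempotent_repr (ee j) (cGe j); exists (Tagged _ r).
exists (fun j => sval (cid (rho_ex j))) => x Gx.
have -> : A = \sum_(j < o) xi ^+ j *: e j.
  by rewrite -[LHS]mulmx1 -sume mulmx_sumr; apply: eq_bigr => j _; rewrite Ae.
rewrite mulmx_suml linear_sum; apply: eq_bigr => j _.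
by case: cid => r /= ->; rewrite // -scalemxAl linearZ.
Qed.

(** Factor [A] through its image: the restriction of [A] to it has the same trace,
    is nilpotent, and has smaller size. *)
Lemma mxtrace_nilpotent n (A : 'M[F]_n) (q : nat) : A ^+ q = 0 -> \tr A = 0.
Proof.
have [m] := ubnP n; elim: m n q A => // m IHm n q A le_nm Aq0.
have [rA | rA] := ltnP (\rank A) n; last first.
  have uA : A \in unitmx by rewrite -row_free_unit /row_free eqn_leq rA rank_leq_row.
  have /eqP : \rank (A ^+ q) = n.
    elim: (q) => [|k IHk]; first by rewrite expr0 mxrank1.
    by rewrite exprSr -mulmxE mxrankMfree ?row_free_unit.
  rewrite Aq0 mxrank0 => /eqP n0; rewrite /mxtrace big1 // => i _.
  by have := ltn_ord i; rewrite -{2}n0.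
rewrite -[A]mulmx_base mxtrace_mulC.
apply: (IHm _ q.+1); first exact: leq_trans rA _.
have shift r (L : 'M_(n, r)) (R : 'M_(r, n)) k :
    L *m R = A -> (R *m L) ^+ k.+1 = R *m A ^+ k *m L.
  move=> LR; elim: k => [|k IHk]; first by rewrite expr1 expr0 mulmx1.
  by rewrite exprS IHk -mulmxE !mulmxA -(mulmxA R L R) LR exprS -mulmxE !mulmxA.
by rewrite shift ?mulmx_base // Aq0 mulmx0 mul0mx.
Qed.

Lemma expr_pchar_comm (R : nzRingType) (p : nat) (x y : R) (e : nat) :
  p \in [pchar R] -> GRing.comm x y -> (x - y) ^+ (p ^ e) = x ^+ (p ^ e) - y ^+ (p ^ e).
Proof.
move=> charRp cxy; elim: e => [|e IHe]; first by rewrite !expn0 !expr1.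
rewrite expnSr !exprM IHe -!(pFrobenius_autE charRp).
by rewrite pFrobenius_autB_comm //; apply: commrX; apply: commr_sym; apply: commrX.
Qed.

(** In characteristic [p], the trace of [x] is that of its [p']-part, as the
    [p]-part is unipotent. *)
Lemma mxtrace_constt (p : nat) n (rG : mx_representation F G n) x :
  p \in [pchar F] -> x \in G -> \tr (rG x) = \tr (rG (x.`_p^')%g).
Proof.
case: n rG => [|n] rG charFp Gx; first by rewrite /mxtrace !big_ord0.
have Gu : (x.`_p)%g \in G by rewrite groupX.
have Gs : (x.`_p^')%g \in G by rewrite groupX.
have charMp : p \in [pchar 'M[F]_n.+1] by rewrite (pchar_lalg 'M[F]_n.+1).
have [e ue] : exists e, ((x.`_p)%g ^+ (p ^ e) = 1)%g.
  exists (logn p #[(x.`_p)%g]%g); rewrite -p_part part_pnat_id ?expg_order //.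
  exact: p_elt_constt.
apply/eqP; rewrite -subr_eq0 -linearB /=; apply/eqP.
apply: (@mxtrace_nilpotent _ _ (p ^ e)%N).
have cus : GRing.comm (rG x) (rG (x.`_p^')%g).
  by rewrite /GRing.comm -!repr_mxMr //; congr (rG _); apply: commuteX.
rewrite expr_pchar_comm // -!repr_mxX // -{1}(consttC p x) expgMn ?ue ?mul1g ?subrr //.
by apply: commuteX2.
Qed.

End Representations.

(** * Separation of irreducible representations in the group algebra *)

Section Separation.

Variables (F : fieldType) (gT : finGroupType) (G : {group gT}).

Local Notation nG := #|G|.
Local Notation aG := (regular_repr F G).

(** Schur's lemma for two representations of possibly different degrees. *)
Lemma schur_rsim n1 n2 (rS : mx_representation F G n1) (rT : mx_representation F G n2)
    (B : 'M_(n1, n2)) :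
  mx_irreducible rS -> mx_irreducible rT -> B != 0 ->
  (forall x, x \in G -> rS x *m B = B *m rT x) -> mx_rsim rS rT.
Proof.
move=> /mx_irrP[_ irrS] /mx_irrP[_ irrT] nzB hB.
have freeB : row_free B.
  rewrite -kermx_eq0; apply: contraT => /irrS fullK.
  have modK : mxmodule rS (kermx B).
    apply/mxmoduleP => x Gx; apply/sub_kermxP.
    by rewrite -mulmxA hB // mulmxA mulmx_ker mul0mx.
  have /row_fullP[K KB] := fullK modK.
  by rewrite -[B]mul1mx -KB -mulmxA mulmx_ker mulmx0 eqxx in nzB.
have rB : \rank B = n2.
  have fullB : row_full <<B>>%MS.
    apply: irrT; last by rewrite -mxrank_eq0 genmxE mxrank_eq0.
    apply/mxmoduleP => x Gx; rewrite genmxE (eqmxMr _ (genmxE B)).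
    by rewrite -hB // submxMl.
  by have /eqP := fullB; rewrite genmxE.
by exists B => //; apply: etrans rB; apply/esym/eqP.
Qed.

(** A simple module killed by the annihilator of a simple module [S] is
    isomorphic to [S]. The annihilator of [S] is the intersection of the
    annihilators of the basis vectors of [S]; adding these one at a time, there is
    a right ideal [L] not killing a fixed vector of [Q] while its intersection with
    the annihilator of the next basis vector [e_i] does. *)
Lemma annihilator_rsim n m (rS : mx_representation F G n) (rQ : mx_representation F G m) :
  mx_irreducible rS -> mx_irreducible rQ ->
  (forall u, gring_mx rS u = 0 -> gring_mx rQ u = 0) -> mx_rsim rS rQ.
Proof.
move=> irrS irrQ annSQ; have /mx_irrP[m_gt0 _] := irrQ.
pose q : 'rV[F]_m := delta_mx 0 (Ordinal m_gt0).
have nz_q : q != 0 by apply/eqP => /rowP/(_ (Ordinal m_gt0))/eqP; rewrite !mxE !eqxx oner_eq0.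
pose L i (u : 'rV[F]_nG) := forall j : 'I_n, (j < i)%N -> row j (gring_mx rS u) = 0.
pose P i := `[< exists2 u, L i u & q *m gring_mx rQ u != 0 >].
have P0 : P 0%N.
  apply/asboolP; exists (gring_row 1%:M) => [j|] //.
  by rewrite gring_mx_row1 mulmx1.
have notPn : ~~ P n.
  apply/negP => /asboolP[u Lu /eqP[]]; rewrite annSQ ?mulmx0 //.
  by apply/row_matrixP => j; rewrite Lu ?row0.
have exP : exists i, ~~ P i by exists n.
case: (ex_minnP exP) => [[|i] notPi min_i]; first by rewrite P0 in notPi.
have lt_in : (i < n)%N by apply: min_i.
have /asboolP[u Lu nzu] : P i by apply: contraT => /min_i; rewrite ltnn.
set q' := q *m gring_mx rQ u in nzu.
pose i0 := Ordinal lt_in; pose w := row i0 (gring_mx rS u).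
have annwq v : w *m gring_mx rS v = 0 -> q' *m gring_mx rQ v = 0.
  move=> wv0; apply/eqP; apply: contraNT notPi => nzv; apply/asboolP.
  exists (u *m gring_mx aG v); last by rewrite gring_mxA mulmxA.
  move=> j; rewrite ltnS gring_mxA row_mul leq_eqVlt => /orP[/eqP Dj | lt_ji].
    by rewrite (_ : j = i0) //; apply: val_inj.
  by rewrite Lu ?mul0mx.
have nz_w : w != 0.
  apply: contraNneq nzu => w0; have:= annwq (gring_row 1%:M).
  by rewrite !gring_mx_row1 !mulmx1 => -> //; rewrite w0.
have /row_fullP[C C1] : row_full (cyclic_mx rS w).
  have /mx_irrP[_] := irrS; apply; first exact: cyclic_mx_module.
  by rewrite cyclic_mx_eq0.
have v_ex j : exists v, w *m gring_mx rS v = row j 1%:M.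
  have /cyclic_mxP[A /submxP[a Da] Dj] : (row j (1%:M : 'M_n) <= cyclic_mx rS w)%MS.
    by rewrite -C1 row_mul submxMl.
  by exists a; rewrite Dj; congr (_ *m _); rewrite /gring_mx /= -Da mxvecK.
(* As [w] generates [S], there is a well defined morphism from [S] to [Q] that
   sends [w] to [q']; [B] is its matrix. *)
pose v j := sval (cid (v_ex j)).
have vE j : w *m gring_mx rS (v j) = row j 1%:M by rewrite /v; case: cid.
pose B := \matrix_j (q' *m gring_mx rQ (v j)).
have DB (a : 'rV_n) y : a = w *m gring_mx rS y -> a *m B = q' *m gring_mx rQ y.
  move=> Da; apply/eqP; rewrite -subr_eq0; apply/eqP.
  have -> : a *m B = q' *m gring_mx rQ (\sum_j a 0 j *: v j).
    rewrite mulmx_sum_row linear_sum mulmx_sumr; apply: eq_bigr => j _.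
    by rewrite rowK linearZ /= -scalemxAr.
  rewrite -mulmxBr -linearB /=; apply: annwq; rewrite linearB mulmxBr -Da /=.
  rewrite linear_sum mulmx_sumr; apply/eqP; rewrite subr_eq0; apply/eqP.
  rewrite [RHS]row_sum_delta; apply: eq_bigr => j _.
  by rewrite linearZ /= -scalemxAr vE row1.
apply: (@schur_rsim _ _ _ _ B) => // [|x Gx].
  apply: contraNneq nzu => B0; have := DB w (gring_row 1%:M).
  by rewrite !gring_mx_row1 !mulmx1 B0 mulmx0 => <-.
apply/row_matrixP => j; rewrite !row_mul.
rewrite rowK -mulmxA -gring_mxJ // (DB _ (v j *m aG x)) //.
by rewrite gring_mxJ // mulmxA vE -row_mul mul1mx.
Qed.

(** Two non-isomorphic simple modules [S] and [T] have comaximal annihilators: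
    otherwise, a simple submodule of the quotient of the group algebra by their
    sum would be isomorphic to both. *)
Lemma separation2 n m (rS : mx_representation F G n) (rT : mx_representation F G m) :
  mx_irreducible rS -> mx_irreducible rT -> ~ mx_rsim rS rT ->
  exists u, gring_mx rS u = 1%:M /\ gring_mx rT u = 0.
Proof.
move=> irrS irrT notST.
(* The row space of [N _ r] is the annihilator of [r] in the group algebra. *)
pose N k (r : mx_representation F G k) := kermx (enveloping_algebra_mx r).
have NP k (r : mx_representation F G k) l (U : 'M_(l, nG)) :
    (U <= N k r)%MS <-> (forall i, gring_mx r (row i U) = 0).
  split=> [sUN i | U0].
    apply/eqP; rewrite -mxvec_eq0 /gring_mx /= vec_mxK; apply/eqP/sub_kermxP.
    exact: submx_trans (row_sub i U) sUN.
  apply/row_subP => i; apply/sub_kermxP; have := U0 i; rewrite /gring_mx /=.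
  by move/(congr1 mxvec); rewrite vec_mxK linear0.
have NPr k (r : mx_representation F G k) (u : 'rV_nG) :
    (u <= N k r)%MS <-> gring_mx r u = 0.
  rewrite NP; split=> [/(_ 0)|u0 i]; first by rewrite row_id.
  by rewrite [i]ord1 row_id.
have modN k (r : mx_representation F G k) : mxmodule aG (N k r).
  apply/mxmoduleP => x Gx; apply/NP => i; rewrite row_mul gring_mxJ //.
  by have /NP -> := submx_refl (N k r); rewrite mul0mx.
pose U := (N _ rS + N _ rT)%MS.
have modU : mxmodule aG U by rewrite addsmx_module.
have [/submx_full fullU | ntU] := boolP (row_full U).
  have /sub_addsmxP[[a b] /= Dab] := fullU _ (gring_row 1%:M : 'rV_nG).
  have Sa : gring_mx rS (a *m N _ rS) = 0 by apply/NPr; rewrite submxMl.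
  have Tb : gring_mx rT (b *m N _ rT) = 0 by apply/NPr; rewrite submxMl.
  exists (b *m N _ rT); split=> //.
  by rewrite -[LHS]add0r -Sa -linearD /= -Dab gring_mx_row1.
pose rM := factmod_repr modU.
have annM u : (forall w : 'rV_nG, (w *m gring_mx aG u <= U)%MS) ->
    gring_mx rM u = 0.
  move=> Uu; have := gring_mx_factmod modU u (val_factmod (1%:M : 'M_(\rank (cokermx U)))).
  rewrite val_factmodK mul1mx => <-; apply/eqP; rewrite in_factmod_eq0.
  by apply/row_subP => i; rewrite row_mul.
have annSM u : gring_mx rS u = 0 -> gring_mx rM u = 0.
  move=> Su0; apply: annM => w; apply: submx_trans (addsmxSl _ _); apply/NPr.
  by rewrite gring_mxA Su0 mulmx0.
have annTM u : gring_mx rT u = 0 -> gring_mx rM u = 0.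
  move=> Tu0; apply: annM => w; apply: submx_trans (addsmxSr _ _); apply/NPr.
  by rewrite gring_mxA Tu0 mulmx0.
have nzM : (1%:M : 'M[F]_(\rank (cokermx U))) != 0.
  by rewrite -mxrank_eq0 mxrank1 mxrank_coker subn_eq0 -ltnNge ltn_neqAle ntU rank_leq_col.
have /asboolP[V simV] : `[< exists V, mxsimple rM V >].
  apply: (mxsimple_exists (mxmodule1 rM) nzM) => -[V simV _].
  by apply/asboolP; exists V.
have modV := mxsimple_module simV.
have irrV : mx_irreducible (submod_repr modV) by apply/submod_mx_irr.
have annV u : gring_mx rM u = 0 -> gring_mx (submod_repr modV) u = 0.
  rewrite -(scale0r 1%:M) scalemx1 => /(gring_mx_submod modV) ->.
  by rewrite -scalemx1 scale0r.
case: notST; apply: mx_rsim_trans (mx_rsim_sym _).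
  by apply: (annihilator_rsim irrS irrV) => u /annSM/annV.
by apply: (annihilator_rsim irrT irrV) => u /annTM/annV.
Qed.

(** An element of the group algebra that acts as the identity on [S] and kills
    finitely many simple modules that are not isomorphic to [S]. *)
Lemma separation (I : Type) (r : seq I) (dim : I -> nat)
    (rT : forall i, mx_representation F G (dim i))
    n (rS : mx_representation F G n) :
  mx_irreducible rS -> (forall i, mx_irreducible (rT i)) ->
  exists u, gring_mx rS u = 1%:M /\
    forall i, List.In i r -> ~ mx_rsim rS (rT i) -> gring_mx (rT i) u = 0.
Proof.
move=> irrS irrT; elim: r => [|i r [u [Su Tu]]].
  by exists (gring_row 1%:M); split=> //; apply: gring_mx_row1.
have [simST | notST] := pselect (mx_rsim rS (rT i)).
  by exists u; split=> // j [<- //|]; apply: Tu.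
have [v [Sv Tv]] := separation2 irrS (irrT i) notST.
exists (u *m gring_mx aG v); split; first by rewrite gring_mxA Su Sv mulmx1.
move=> j [<- _ | rj notSTj]; first by rewrite gring_mxA Tv mulmx0.
by rewrite gring_mxA (Tu j) // mul0mx.
Qed.

End Separation.

(** * Irreducible representations and [p]-regular classes *)

Section RegularClasses.

Variables (gT : finGroupType) (G : {group gT}).

Local Notation nG := #|G|.

(** The conjugacy classes of [p']-elements of [G]. *)
Definition preg_classes (p : nat) : {set {set gT}} :=
  [set (x ^: G)%g | x in G & ((p^').-elt x)%g].

(** There are no more irreducible representations in characteristic [p] than
    classes of [p']-elements. Over a splitting field, simple submodules of
    their scalar extensions have non-zero traces; by [separation], these are
    linearly independent functions on the group, determined by their values
    at [p']-elements. *)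
Lemma leq_irr_preg (F : fieldType) (p r : nat) (dim : 'I_r -> nat)
    (rS : forall i, mx_representation F G (dim i)) :
  p \in [pchar F] -> (forall i, mx_irreducible (rS i)) ->
  (forall i j, mx_rsim (rS i) (rS j) -> i = j) -> (r <= #|preg_classes p|)%N.
Proof.
move=> charFp irrS simS.
apply: (@group_splitting_field_exists gT G F) => -[Fs f splitFs].
have charFsp : p \in [pchar Fs] by rewrite (fmorph_pchar f).
have /fin_all_exists[t tP] i : exists t : {n : nat & mx_representation Fs G n},
    mx_absolutely_irreducible (tagged t) /\
    forall u c, gring_mx (rS i) u = c%:M ->
      gring_mx (tagged t) (map_mx f u) = (f c)%:M.
  pose rS' := map_repr f (rS i).
  have nz1 : (1%:M : 'M[Fs]_(dim i)) != 0.
    by rewrite -mxrank_eq0 mxrank1 -lt0n; have /mx_irrP[] := irrS i.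
  have /asboolP[V simV] : `[< exists V, mxsimple rS' V >].
    apply: (mxsimple_exists (mxmodule1 rS') nz1) => -[V simV _].
    by apply/asboolP; exists V.
  have modV := mxsimple_module simV.
  exists (Tagged _ (submod_repr modV)); split; first by apply/splitFs/submod_mx_irr.
  move=> u c Du; apply: gring_mx_submod.
  by rewrite -map_gring_mx Du map_scalar_mx.
pose C := preg_classes p; pose c (k : 'I_#|C|) : gT := repr (enum_val k).
pose Psi : 'M[Fs]_(r, #|C|) := \matrix_(i, k) \tr (tagged (t i) (c k)).
suffices freePsi : row_free Psi by rewrite -(eqP freePsi) rank_leq_col.
apply/row_freeP; apply/row_freeP; rewrite -kermx_eq0; apply/rowV0P => u.
move/sub_kermxP => uPsi.
have tr0s x : x \in G -> (p^'.-elt x)%g -> \sum_i u 0 i * \tr (tagged (t i) x) = 0.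
  move=> Gx px; have Cx : (x ^: G)%g \in C by apply/imsetP; exists x; rewrite // inE Gx.
  have := congr1 (fun M : 'M_(1, #|C|) => M 0 (enum_rank_in Cx (x ^: G)%g)) uPsi.
  rewrite !mxE; apply: etrans; apply: eq_bigr => i _; rewrite mxE; congr (_ * _).
  rewrite /c enum_rankK_in //.
  have /imsetP[y Gy ->] := mem_repr x (class_refl G x).
  by rewrite conjgE !repr_mxM ?groupM ?groupV // mxtrace_mulC -mulmxA -repr_mxM ?groupV // mulgV repr_mx1 mulmx1.
have tr0 x : x \in G -> \sum_i u 0 i * \tr (tagged (t i) x) = 0.
  move=> Gx; transitivity (\sum_i u 0 i * \tr (tagged (t i) (x.`_p^')%g)); last first.
    by apply: tr0s; rewrite ?groupX ?p_elt_constt.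
  by apply: eq_bigr => i _; rewrite (mxtrace_constt _ charFsp).
have tr0v v : \sum_i u 0 i * \tr (gring_mx (tagged (t i)) v) = 0.
  rewrite (eq_bigr (fun i => \sum_k v 0 k * (u 0 i * \tr (tagged (t i) (enum_val k))))).
    rewrite exchange_big big1 //= => k _.
    by rewrite -mulr_sumr tr0 ?mulr0 ?enum_valP.
  move=> i _; rewrite gring_mx_sum linear_sum mulr_sumr; apply: eq_bigr => k _.
  by rewrite linearZ /= mulrCA.
apply/rowP => j; rewrite mxE.
have [absT _] := tP j; have /mx_abs_irrP[n_gt0 [a_ a_G]] := absT.
have [e [e1 e0]] := separation (enum 'I_r) (irrS j) irrS.
pose i0 := Ordinal n_gt0.
have /submxP[v Dv] : (mxvec (delta_mx i0 i0) <= enveloping_algebra_mx (tagged (t j)))%MS.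
  by apply: submx_full; case/andP: absT.
(* Multiplication by [e] kills all the terms but that of [j], where [v] acts with
   trace [1]. *)
have := tr0v (map_mx f e *m gring_mx (regular_repr Fs G) v).
rewrite (bigD1 j) //= big1 => [|i ne_ij].
  rewrite addr0 gring_mxA (proj2 (tP j) _ _ e1) rmorph1 mul1mx.
  rewrite [gring_mx _ v]/= /gring_mx /= -Dv mxvecK /mxtrace (bigD1 i0) //= big1.
    by rewrite addr0 !mxE !eqxx mulr1.
  by move=> l ne_li; rewrite mxE (negbTE ne_li).
rewrite gring_mxA (proj2 (tP i) e 0) ?rmorph0 -?scalemx1 ?scale0r ?mul0mx ?linear0 ?mulr0 //.
apply: e0 => [|/simS eq_ji]; last by rewrite eq_ji eqxx in ne_ij.
by elim: (enum _) (mem_enum 'I_r i) => //= k s IHs; rewrite inE => /orP[/eqP ->|/IHs]; auto.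
Qed.

(** The indicator function of the class of [g] is, up to the order of the
    centraliser of [g], the trace on the regular module of the commuting
    action of [g], and thus a linear combination of characters. *)
Lemma class_indicator_repr (F : fieldType) (g : gT) (xi : F) :
  g \in G -> #[g]%g.-primitive_root xi ->
  exists rho : 'I_#[g]%g -> {m : nat & mx_representation F G m},
    forall x, x \in G ->
      \sum_(j < #[g]%g) xi ^+ j * \tr (tagged (rho j) x) =
        if x \in (g ^: G)%g then #|('C_G[g])%g|%:R else 0.
Proof.
move=> Gg prim_xi.
pose ix := gring_index G; pose v (i : 'I_nG) : gT := enum_val i.
have Gv i : v i \in G by apply: enum_valP.
have vK x : x \in G -> v (ix x) = x by apply: gring_indexK.
have Kv i : ix (v i) = i by apply: gring_valK.
(* [Lm h] is the left translation by [h], which commutes with the right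
   translations of the regular representation. *)
pose Lm (h : gT) : 'M[F]_nG := \matrix_i delta_mx 0 (ix (h * v i)%g).
have LmM h k : h \in G -> k \in G -> Lm h *m Lm k = Lm (k * h)%g.
  move=> Gh Gk; apply/row_matrixP => i; rewrite row_mul !rowK -rowE rowK.
  by rewrite vK ?groupM // mulgA.
have Gg1 : (g^-1)%g \in G by rewrite groupV.
have LmX k : Lm (g^-1)%g ^+ k = Lm (g^-1 ^+ k)%g.
  elim: k => [|k IHk].
    rewrite expr0; apply/row_matrixP => i.
    by rewrite rowK expg0 mul1g Kv row1.
  by rewrite exprS IHk -mulmxE LmM ?groupX // -expgSr.
have Lm1 : Lm (g^-1)%g ^+ #[g]%g = 1.
  rewrite LmX expgVn expg_order invg1; apply/row_matrixP => i.
  by rewrite rowK mul1g Kv row1.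
have LmC x : x \in G -> Lm (g^-1)%g *m regular_repr F G x = regular_repr F G x *m Lm (g^-1)%g.
  move=> Gx; apply/row_matrixP => i; rewrite !row_mul !rowK -!rowE !rowK.
  by rewrite /v /ix !gring_indexK ?groupM ?enum_valP // !mulgA.
have [rho rhoP] := eigen_repr prim_xi Lm1 LmC.
exists rho => x Gx; rewrite -rhoP //.
have -> : \tr (Lm (g^-1)%g *m regular_repr F G x) = #|[set y in G | (g ^ y == x)%g]|%:R.
  rewrite /mxtrace -[in RHS]sum1_card natr_sum.
  rewrite (eq_bigr (fun i => if (g ^ v i == x)%g then 1 else 0)) => [|i _].
    rewrite -big_mkcond /= (reindex_onto v ix) /=; last by move=> y; rewrite inE => /andP[Gy _]; rewrite vK.
    by apply: eq_bigl => i; rewrite inE Gv Kv eqxx andbT.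
  have := congr1 (fun M : 'M[F]_(1, nG) => M 0 i) (row_mul i (Lm (g^-1)%g) (regular_repr F G x)).
  rewrite rowK -rowE rowK /v /ix gring_indexK ?groupM ?enum_valP // !mxE => ->.
  rewrite -/(v i) -/ix eqxx /=.
  have -> : (i == ix (g^-1 * v i * x)%g) = ((g ^ v i)%g == x).
    rewrite -(inj_eq (can_inj Kv)) vK ?groupM //.
    rewrite -(inj_eq (mulgI g)) -(mulgA g^-1%g) mulKVg conjgE.
    by rewrite -[RHS](inj_eq (mulgI (v i))) mulKVg.
  by case: ifP.
case: ifP => [/imsetP[z Gz Dx] | xg]; last first.
  rewrite (_ : [set y in G | _] = finset.set0) ?cards0 //; apply/setP => y; rewrite !inE.
  apply/andP => -[Gy /eqP Dx]; case/negP: (negbT xg); rewrite -Dx.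
  by apply: memJ_class.
congr _%:R; rewrite -[RHS](card_rcoset _ z); apply: eq_card => y; rewrite [RHS]mem_rcoset [LHS]inE [RHS]finset.in_setI.
rewrite groupMr ?groupV // Dx; congr (_ && _).
apply/eqP/cent1P => [Dy | cgy].
  by apply/commute_sym/commgP/conjg_fixP; rewrite conjgM Dy conjgK.
have := cgy; move/commute_sym/commgP/conjg_fixP; rewrite conjgM => /(congr1 (conjg^~ z)).
by rewrite conjgKV.
Qed.

End RegularClasses.

(** * Characteristic polynomials *)

Lemma char_poly_conj (F : fieldType) m n (A : 'M[F]_n) (D : 'M_m) (B : 'M_(m, n)) :
  m = n -> row_free B -> B *m A = D *m B -> char_poly D = char_poly A.
Proof.
move=> eq_mn; case: n / eq_mn A B => A B; rewrite row_free_unit => uB BA.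
pose PB := map_mx polyC B.
have PBA : PB *m char_poly_mx A = char_poly_mx D *m PB.
  rewrite /char_poly_mx mulmxBr mulmxBl -!map_mxM /= BA; congr (_ - _).
  by rewrite mul_mx_scalar mul_scalar_mx.
have nzB : \det PB != 0 by rewrite det_map_mx polyC_eq0 -unitfE -unitmxE.
apply: (mulIf nzB); have /(congr1 determinant) := PBA.
by rewrite !det_mulmx mulrC => <-.
Qed.

(** In a basis adapted to a submodule [U], the matrices are block triangular. *)
Lemma char_poly_sub_fact (F : fieldType) (gT : finGroupType) (G : {group gT}) n
    (rG : mx_representation F G n) (U : 'M_n) (modU : mxmodule rG U) x :
  x \in G ->
  char_poly (rG x) = char_poly (submod_repr modU x) * char_poly (factmod_repr modU x).
Proof.
move=> Gx; pose S := submod_repr modU x; pose T := factmod_repr modU x.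
pose B1 : 'M_(\rank U, n) := val_submod 1%:M.
pose B2 : 'M_(\rank (cokermx U), n) := val_factmod 1%:M.
pose B := col_mx B1 B2; pose C := in_submod U (B2 *m rG x).
have fullB : row_full B.
  apply/row_fullP; exists (row_mx (in_submod U 1%:M) (in_factmod U 1%:M)).
  by rewrite mul_row_col -val_submodE -val_factmodE add_sub_fact_mod.
have Dmn : (\rank U + \rank (cokermx U))%N = n by rewrite mxrank_coker subnKC ?rank_leq_row.
have freeB : row_free B by rewrite /row_free (eqP fullB) Dmn.
have DB : B *m rG x = block_mx S 0 C T *m B.
  rewrite mul_col_mx mul_block_col mul0mx addr0; congr col_mx.
    rewrite -val_submodE /S /= -[X in _ = val_submod X]mul1mx (val_submodJ modU) //.
  by rewrite -[LHS](add_sub_fact_mod U) val_submodE val_factmodE.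
rewrite -(char_poly_conj Dmn freeB DB) /char_poly /char_poly_mx.
rewrite map_block_mx (scalar_mx_block _ _ 'X) opp_block_mx add_block_mx.
by rewrite map_mx0 oppr0 addr0 det_lblock.
Qed.

(** A matrix of finite order [o] is diagonalisable over a field that contains the
    [o]-th roots of unity, with eigenvalues among these roots. *)
Lemma char_poly_unity (F : fieldType) n (A : 'M[F]_n) (o : nat) (xi : F) :
  o.-primitive_root xi -> A ^+ o = 1 ->
  exists2 l : seq F, (forall z, z \in l -> z ^+ o = 1)
    & char_poly A = \prod_(z <- l) ('X - z%:P).
Proof.
move=> prim_xi; case: n A => [|n] A Ao.
  by exists [::] => //; rewrite big_nil /char_poly det_mx00.
pose rs := [seq xi ^+ i | i <- index_iota 0 o].
have Ers : \prod_(z <- rs) ('X - z%:P) = 'X^o - 1.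
  by rewrite big_map factor_Xn_sub_1.
have dvdA : mxminpoly A %| 'X^o - 1.
  by apply: mxminpoly_min; rewrite rmorphB rmorphXn /= horner_mx_X Ao rmorph1 subrr.
have urs : uniq rs.
  rewrite map_inj_in_uniq ?iota_uniq // => i j; rewrite !mem_index_iota /= => lt_i lt_j.
  by move/eqP; rewrite (eq_prim_root_expr prim_xi) !modn_small // => /eqP.
have /diagonalizableP[P uP] : exists2 rs, uniq rs & mxminpoly A %| \prod_(x <- rs) ('X - x%:P).
  by exists rs; rewrite ?Ers.
case/diagonalizable_forPex => D /(simmxP uP) PA.
have DA : char_poly A = \prod_(z <- codom (fun i => D 0 i)) ('X - z%:P).
  rewrite -(char_poly_conj (erefl _) _ PA) ?row_free_unit // char_poly_trig ?diag_mx_is_trig //.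
  by rewrite big_image /=; apply: eq_bigr => i _; rewrite mxE eqxx.
exists (codom (fun i => D 0 i)) => // z Dz.
have : root (char_poly A) z by rewrite DA root_prod_XsubC.
rewrite -root_mxminpoly => root_z; have := root_dvdp dvdA root_z.
by rewrite /root !hornerE subr_eq0 => /eqP.
Qed.

Lemma mxtrace_char_poly (R : idomainType) n (A : 'M[R]_n) (l : seq R) :
  char_poly A = \prod_(z <- l) ('X - z%:P) -> \tr A = \sum_(z <- l) z.
Proof.
move=> DA; have sz_l : size l = n.
  by apply: succn_inj; rewrite -(size_char_poly A) DA size_prod_XsubC.
case: n A DA sz_l => [|n] A DA sz_l.
  by rewrite (size0nil sz_l) big_nil /mxtrace big_ord0.
apply: oppr_inj; rewrite -char_poly_trace // DA -sz_l coefPn_prod_XsubC ?sz_l //.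
Qed.

(** * The valuation ring of a modular system *)

Section ModularSystem.

Variables (p : nat) (M : modular_system p).
Local Notation O := (ringO M).
Local Notation K := (fracK M).
Local Notation k := (resk M).

Lemma emb_inj : injective (emb M).
Proof. by case: (modular_fraction M). Qed.

Lemma modular_prime : prime p.
Proof. exact: pcharf_prime (modular_pchar_res M). Qed.

(** A finite family of elements of [K], not all zero, has a non-zero member
    that divides all the others: one of minimal valuation. *)
Lemma min_valuation (I : finType) (f : I -> K) (i0 : I) :
  f i0 != 0 -> exists2 i, f i != 0 & forall j, exists a, f j = emb M a * f i.
Proof.
move=> nz0; have [v [[_ vM _] Ov _]] := modular_dvr M.
have [i nzi min_i] := @Order.TotalTheory.arg_minP _ _ I i0 [pred i | f i != 0] (fun i => v (f i)) nz0.
rewrite /= in nzi; exists i => // j; have [-> | nzj] := eqVneq (f j) 0; first by exists 0; rewrite rmorph0 mul0r.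
have [a Da] : exists a, f j / f i = emb M a.
  apply/Ov; rewrite /val_ge; apply/orP; right.
  have nz_ji : f j / f i != 0 by rewrite mulf_neq0 ?invr_eq0.
  have : v (f i) <= v (f j) by apply: min_i.
  by rewrite -{1}(divfK nzi (f j)) (vM (f j / f i)) // lerDr.
by exists a; rewrite -Da divfK.
Qed.

Lemma unity_in_ring (x : K) (o : nat) : (o > 0)%N -> x ^+ o = 1 ->
  exists2 a : O, x = emb M a & a ^+ o = 1.
Proof.
move=> o_gt0 xo1; suffices [a Da] : exists a, x = emb M a.
  by exists a => //; apply: emb_inj; rewrite rmorphXn rmorph1 /= -Da.
pose f (b : bool) := if b then x else 1.
(* Either [x] or its inverse, which is a power of [x], lies in the ring. *)
have [[] _ div_x] := @min_valuation _ f false (oner_neq0 _); last first.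
  by have [a /= ->] := div_x true; exists a; rewrite mulr1.
have [a /= Da] := div_x false; exists (a ^+ o.-1); rewrite rmorphXn /=.
rewrite -[LHS]mul1r -[X in X * _](expr1n _ o.-1) Da exprMn -mulrA -exprSr prednK //.
by rewrite xo1 mulr1.
Qed.

(** Reduction is injective on roots of unity of order prime to [p]. *)
Lemma res_unity_inj (o : nat) (a b : O) : ~~ (p %| o)%N ->
  a ^+ o = 1 -> b ^+ o = 1 -> res M a = res M b -> a = b.
Proof.
move=> p'o a1 b1 eq_ab; have o_gt0 : (o > 0)%N by case: (o) p'o; rewrite ?dvdn0.
pose c := a * b ^+ o.-1.
have bb : b ^+ o.-1 * b = 1 by rewrite -exprSr prednK.
have c1 : c ^+ o = 1 by rewrite exprMn a1 mul1r exprAC b1 expr1n.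
have rc : res M c = 1 by rewrite rmorphM rmorphXn /= eq_ab -exprS prednK // -rmorphXn b1 rmorph1.
have : (c - 1) * \sum_(i < o) c ^+ i = 0 by rewrite -subrX1 c1 subrr.
move/eqP; rewrite mulf_eq0 => /orP[|/eqP/(congr1 (res M))].
  rewrite subr_eq0 => /eqP Dc; by rewrite -[a]mulr1 -bb mulrA -/c Dc mul1r.
rewrite rmorph_sum rmorph0 (eq_bigr (fun=> 1)) => [|i _]; last by rewrite rmorphXn rc expr1n.
rewrite sumr_const card_ord => /eqP.
by rewrite -(dvdn_pcharf (modular_pchar_res M)) (negbTE p'o).
Qed.

Lemma res_prim_root (o : nat) (a : O) : ~~ (p %| o)%N ->
  o.-primitive_root (emb M a) -> o.-primitive_root (res M a).
Proof.
move=> p'o prim_a; have o_gt0 := prim_order_gt0 prim_a.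
have a1 : a ^+ o = 1.
  by apply: emb_inj; rewrite rmorphXn rmorph1 /= prim_expr_order.
have ra1 : res M a ^+ o = 1 by rewrite -rmorphXn a1 rmorph1.
have [d prim_d dv_do] := prim_order_exists o_gt0 ra1.
suffices <- : d = o by [].
apply/eqP; rewrite eqn_dvd dv_do (prim_order_dvd prim_a) -rmorphXn.
rewrite (@res_unity_inj o (a ^+ d) 1) ?rmorph1 ?expr1n ?eqxx //.
  by rewrite exprAC a1 expr1n.
by rewrite rmorphXn /= prim_expr_order.
Qed.

Lemma unity_roots_uniq (o : nat) (l1 l2 : seq O) : ~~ (p %| o)%N ->
  (forall a, a \in l1 -> a ^+ o = 1) -> (forall a, a \in l2 -> a ^+ o = 1) ->
  \prod_(a <- l1) ('X - (res M a)%:P) = \prod_(a <- l2) ('X - (res M a)%:P) ->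
  perm_eq l1 l2.
Proof.
move=> p'o; elim: l1 l2 => [|a l1 IHl] l2 o1 o2.
  rewrite big_nil => /(congr1 (fun q : {poly _} => size q)).
  by rewrite size_poly1 size_prod_XsubC => -[] /esym/size0nil ->.
move=> eq12; have a1 : a ^+ o = 1 by rewrite o1 ?mem_head.
have al2 : a \in l2.
  have : root (\prod_(b <- map (res M) l2) ('X - b%:P)) (res M a).
    by rewrite big_map -eq12 big_cons rootM root_XsubC eqxx.
  rewrite root_prod_XsubC => /mapP[b l2b Dab].
  by rewrite (res_unity_inj p'o a1 (o2 b l2b) Dab).
rewrite (perm_trans _ (_ : perm_eq (a :: rem a l2) l2)) //; last first.
  by rewrite perm_sym perm_to_rem.
rewrite perm_cons; apply: IHl => [b l1b|b l2b|].
- by rewrite o1 // inE l1b orbT.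
- by rewrite o2 // (mem_rem l2b).
apply: (@mulfI _ ('X - (res M a)%:P)); first by rewrite polyXsubC_eq0.
by have := eq12; rewrite big_cons (perm_big _ (perm_to_rem al2)) big_cons.
Qed.

End ModularSystem.

(** * Brauer characters and reduction modulo [p] *)

Section BrauerCharacters.

Variables (p : nat) (M : modular_system p) (gT : finGroupType) (H : {group gT}).
Local Notation O := (ringO M).
Local Notation K := (fracK M).
Local Notation k := (resk M).

Hypothesis hK : exists z : K, #|H|.-primitive_root z.

Lemma elt_prim_root s : s \in H -> exists a : O, #[s]%g.-primitive_root (emb M a).
Proof.
move=> Hs; have [z prim_z] := hK; have prim_s := dvdn_prim_root prim_z (order_dvdG Hs).
have [a Da _] := unity_in_ring (prim_order_gt0 prim_s) (prim_expr_order prim_s).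
by exists a; rewrite -Da.
Qed.

Lemma p'elt_ndvd (s : gT) : (p^'.-elt s)%g -> ~~ (p %| #[s]%g)%N.
Proof. by rewrite /p_elt p'natE // (modular_prime M). Qed.

Lemma repr_order (F : fieldType) n (rH : mx_representation F H n) s :
  s \in H -> rH s ^+ #[s]%g = 1.
Proof.
move=> Hs; have rX i : rH s ^+ i = rH (s ^+ i)%g.
  elim: i => [|i IHi]; first by rewrite expg0 repr_mx1.
  by rewrite exprS IHi expgS repr_mxM ?groupX.
by rewrite rX expg_order repr_mx1.
Qed.

Lemma brauer_char_poly n (rH : mx_representation k H n) s :
  s \in H -> (p^'.-elt s)%g ->
  exists2 l : seq O, (forall a, a \in l -> a ^+ #[s]%g = 1)
    & char_poly (rH s) = \prod_(a <- l) ('X - (res M a)%:P).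
Proof.
move=> Hs /p'elt_ndvd p's; have [b prim_b] := elt_prim_root Hs.
have b1 : b ^+ #[s]%g = 1.
  by apply: (@emb_inj _ M); rewrite rmorphXn rmorph1 /= prim_expr_order.
have prim_rb := res_prim_root p's prim_b.
have [l l1 ->] := char_poly_unity prim_rb (repr_order rH Hs).
elim: l l1 => [|z l IHl] l1; first by exists [::]; rewrite ?big_nil.
have [|l' l'1 eq_l] := IHl; first by move=> y ly; rewrite l1 // inE ly orbT.
have /(prim_rootP prim_rb)[i Dz] := l1 z (mem_head z l).
exists (b ^+ i :: l') => [a|].
  by rewrite inE => /predU1P[->|/l'1 //]; rewrite exprAC b1 expr1n.
by rewrite !big_cons eq_l rmorphXn /= Dz.
Qed.

Lemma brauer_affords_exists n (rH : mx_representation k H n) :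
  exists phi, brauer_affords rH phi.
Proof.
have l_ex s : exists l : seq O, s \in H -> (p^'.-elt s)%g ->
    (forall a, a \in l -> a ^+ #[s]%g = 1) /\
    char_poly (rH s) = \prod_(a <- l) ('X - (res M a)%:P).
  have [/andP[Hs p's]|ns] := boolP ((s \in H) && (p^'.-elt s)%g).
    by have [l ? ?] := brauer_char_poly rH Hs p's; exists l.
  by exists [::] => Hs p's; rewrite Hs p's in ns.
pose l s := sval (cid (l_ex s)).
exists [ffun s => if (s \in H) && (p^'.-elt s)%g then \sum_(a <- l s) emb M a else 0].
split=> [s Hs p's | s /negbTE ns]; last by rewrite ffunE ns.
rewrite ffunE Hs p's; exists (l s); rewrite /l; case: cid => l' /= l'P.
by have [? ?] := l'P Hs p's.
Qed.

(** A Brauer character is additive on short exact sequences, since the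
    characteristic polynomial is multiplicative. *)
Lemma brauer_affords_prod n n1 n2 (rH : mx_representation k H n)
    (r1 : mx_representation k H n1) (r2 : mx_representation k H n2) phi phi1 phi2 :
  (forall s, s \in H -> char_poly (rH s) = char_poly (r1 s) * char_poly (r2 s)) ->
  brauer_affords rH phi -> brauer_affords r1 phi1 -> brauer_affords r2 phi2 ->
  phi = phi1 + phi2.
Proof.
move=> DrH [phiP phi0] [phi1P phi10] [phi2P phi20]; apply/ffunP => s.
rewrite ffunE; have [/andP[Hs p's]|ns] := boolP ((s \in H) && (p^'.-elt s)%g); last first.
  by rewrite phi0 // phi10 // phi20 // addr0.
have [l [l1 Dl ->]] := phiP s Hs p's; have [l' [l'1 Dl' ->]] := phi1P s Hs p's.
have [l'' [l''1 Dl'' ->]] := phi2P s Hs p's.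
rewrite -big_cat; apply: perm_big; apply: unity_roots_uniq (p'elt_ndvd p's) l1 _ _.
  by move=> a; rewrite mem_cat => /orP[/l'1|/l''1].
by rewrite big_cat /= -Dl -Dl' -Dl'' DrH.
Qed.

Lemma brauer_affords0 (rH : mx_representation k H 0) phi :
  brauer_affords rH phi -> phi = 0.
Proof.
move=> rHphi; apply: (addrI phi); rewrite addr0.
apply/esym; apply: (brauer_affords_prod _ rHphi rHphi rHphi) => s _.
by rewrite /char_poly !det_mx00 mulr1.
Qed.

Lemma brauer_affords_rsim n1 n2 (r1 : mx_representation k H n1)
    (r2 : mx_representation k H n2) phi1 phi2 :
  mx_rsim r1 r2 -> brauer_affords r1 phi1 -> brauer_affords r2 phi2 -> phi1 = phi2.
Proof.
case=> B eq_n freeB hB r1phi r2phi.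
have rep0 : mx_repr H (fun _ : gT => 0 : 'M[k]_0).
  by split=> [|x y _ _]; apply/matrixP => -[].
have [phi0 r0phi] := brauer_affords_exists (MxRepresentation rep0).
rewrite -[phi2]addr0 -(brauer_affords0 r0phi).
apply: brauer_affords_prod r1phi r2phi r0phi => s Hs.
rewrite [X in _ * X]/char_poly det_mx00 mulr1.
by apply: (char_poly_conj eq_n freeB); rewrite hB.
Qed.

Lemma brauer_affords_irr_sum n (rH : mx_representation k H n) phi :
  brauer_affords rH phi ->
  exists2 l : seq {ffun gT -> K}, (forall psi, psi \in l -> IBr M H psi)
    & phi = \sum_(psi <- l) psi.
Proof.
move: n rH phi; apply: repr_ind => [rH phi | n rH irrH phi | n rH U modU].
- by move/brauer_affords0 => ->; exists [::]; rewrite ?big_nil.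
- move=> rHphi; exists [:: phi]; last by rewrite big_seq1.
  by move=> psi; rewrite inE => /eqP ->; exists n, rH.
move=> IH1 IH2 phi rHphi.
have [phi1 r1phi] := brauer_affords_exists (submod_repr modU).
have [phi2 r2phi] := brauer_affords_exists (factmod_repr modU).
have [l1 l1P D1] := IH1 _ r1phi; have [l2 l2P D2] := IH2 _ r2phi.
exists (l1 ++ l2) => [psi|]; first by rewrite mem_cat => /orP[/l1P|/l2P].
rewrite big_cat /= -D1 -D2; apply: brauer_affords_prod rHphi r1phi r2phi => s.
exact: char_poly_sub_fact.
Qed.

(** Every representation over [K] is realised over [O]. Among the bases of [K^n]
    made of vectors [e_i h], choose one with a determinant of minimal valuation:
    by Cramer's rule, all the vectors [e_i h] have coordinates in [O] in it, and
    the lattice that they span is stable. *)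
Lemma integral_form n (rV : mx_representation K H n) :
  exists (rO : mx_representation O H n) (P : 'M[K]_n), P \in unitmx /\
    forall x, x \in H -> P *m rV x = map_mx (emb M) (rO x) *m P.
Proof.
pose I := {ffun 'I_n -> subg_of H * 'I_n}.
pose B (f : I) : 'M[K]_n := \matrix_i row (f i).2 (rV (sgval (f i).1)).
pose f0 : I := [ffun i => (1%g, i)].
have nz0 : \det (B f0) != 0.
  rewrite (_ : B f0 = 1%:M) ?det1 ?oner_eq0 //; apply/row_matrixP => i.
  by rewrite rowK ffunE /= repr_mx1.
have [f nzf min_f] := @min_valuation _ M _ (fun f => \det (B f)) f0 nz0.
pose P := B f; have uP : P \in unitmx by rewrite unitmxE unitfE.
pose fx (x : gT) : I := [ffun i => ((f i).1 * subg H x, (f i).2)%g].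
have Bx x : x \in H -> P *m rV x = B (fx x).
  move=> Hx; apply/row_matrixP => i; rewrite row_mul !rowK ffunE /=.
  by rewrite subgK // repr_mxM ?subgP // row_mul.
(* The coordinates are quotients of two determinants of the family. *)
have ex_a x i j : exists a, (B (fx x) *m invmx P) i j = emb M a.
  pose g : I := [ffun l => if l == j then fx x i else f l].
  have [a Da] := min_f g; exists a.
  rewrite /invmx uP -scalemxAr mxE; apply: (mulIf nzf); rewrite -Da mulrAC mulVf // mul1r.
  rewrite (expand_det_row _ j) mxE; apply: eq_bigr => l _; congr (_ * _).
    by rewrite !mxE !ffunE eqxx.
  rewrite mxE /cofactor; congr (_ * \det _); apply/matrixP => i1 j1.
  by rewrite !mxE ffunE eq_sym (negbTE (neq_lift j i1)).
pose rO x : 'M[O]_n := \matrix_(i, j) sval (cid (ex_a x i j)).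
have rOE x : map_mx (emb M) (rO x) = B (fx x) *m invmx P.
  by apply/matrixP => i j; rewrite [LHS]mxE [rO x i j]mxE; case: cid.
have rOP x : x \in H -> map_mx (emb M) (rO x) = P *m rV x *m invmx P.
  by move=> Hx; rewrite rOE Bx.
have rO_repr : mx_repr H rO.
  have inj_emb (A B' : 'M[O]_n) : map_mx (emb M) A = map_mx (emb M) B' -> A = B'.
    by move/matrixP => eqAB; apply/matrixP => i j; have := eqAB i j; rewrite !mxE => /emb_inj.
  split=> [|x y Hx Hy]; apply: inj_emb.
    by rewrite rOP // repr_mx1 mulmx1 mulmxV // map_mx1.
  by rewrite map_mxM !rOP ?groupM // repr_mxM // !mulmxA mulmxKV.
exists (MxRepresentation rO_repr), P; split=> // x Hx.
by rewrite /= rOP // mulmxKV.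
Qed.

(** The restriction of a character to the [p']-elements is a sum of
    irreducible Brauer characters. *)
Lemma decomposition n (rV : mx_representation K H n) :
  exists2 l : seq {ffun gT -> K}, (forall psi, psi \in l -> IBr M H psi)
    & forall s, s \in H -> (p^'.-elt s)%g -> \tr (rV s) = \sum_(psi <- l) psi s.
Proof.
have [rO [P [uP PrV]]] := integral_form rV.
pose rk := map_repr (res M) rO.
pose phi : {ffun gT -> K} := [ffun s => if (s \in H) && (p^'.-elt s)%g then \tr (rV s) else 0].
have rkphi : brauer_affords rk phi.
  split=> [s Hs p's | s /negbTE ns]; last by rewrite ffunE ns.
  have [a prim_a] := elt_prim_root Hs.
  have a1 : a ^+ #[s]%g = 1.
    by apply: (@emb_inj _ M); rewrite rmorphXn rmorph1 /= prim_expr_order.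
  have [l l1 Dl] := char_poly_unity prim_a (repr_order rV Hs).
  have [l' Dl' l'1] : exists2 l' : seq O, l = map (emb M) l' & forall b, b \in l' -> b ^+ #[s]%g = 1.
    elim: l l1 {Dl} => [|z l IHl] l1; first by exists [::].
    have [|l' -> l'1] := IHl; first by move=> y ly; rewrite l1 // inE ly orbT.
    have /(prim_rootP prim_a)[i Dz] := l1 z (mem_head z l).
    exists (a ^+ i :: l'); first by rewrite /= rmorphXn /= Dz.
    by move=> b; rewrite inE => /predU1P[->|/l'1 //]; rewrite exprAC a1 expr1n.
  have DrO : char_poly (rO s) = \prod_(b <- l') ('X - b%:P).
    apply: (map_inj_poly (@emb_inj _ M) (rmorph0 _)).
    rewrite map_char_poly (char_poly_conj (erefl n) _ (PrV s Hs)) ?row_free_unit //.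
    rewrite Dl Dl' big_map rmorph_prod; apply: eq_bigr => b _.
    by rewrite rmorphB /= map_polyX map_polyC.
  exists l'; split=> //.
    rewrite /rk /= /map_repr_mx -map_char_poly DrO rmorph_prod /=.
    by apply: eq_bigr => b _; rewrite rmorphB /= map_polyX map_polyC.
  by rewrite ffunE Hs p's (mxtrace_char_poly Dl) Dl' big_map.
have [l lP Dphi] := brauer_affords_irr_sum rkphi; exists l => // s Hs p's.
have := congr1 (fun f : {ffun gT -> K} => f s) Dphi.
by rewrite /phi ffunE Hs p's sum_ffunE.
Qed.

End BrauerCharacters.

(** * Linear independence of the irreducible Brauer characters *)

Lemma sum_count_mem (T : eqType) (R : pzSemiRingType) (Phi L : seq T) (F : T -> R) :
  uniq Phi -> {subset L <= Phi} ->
  \sum_(psi <- L) F psi = \sum_(phi <- Phi) (count_mem phi L)%:R * F phi.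
Proof.
move=> uPhi; elim: L => [|psi L IHL] sLP.
  by rewrite big_nil big1 // => phi _; rewrite mul0r.
rewrite big_cons IHL => [|psi' Lpsi']; last by apply: sLP; rewrite inE Lpsi' orbT.
rewrite [RHS](eq_bigr (fun phi => (psi == phi)%:R * F phi + (count_mem phi L)%:R * F phi)).
  rewrite big_split /=; congr (_ + _).
  rewrite (bigD1_seq psi) ?sLP ?mem_head //= eqxx mul1r big1 ?addr0 // => phi.
  by rewrite eq_sym => /negbTE ->; rewrite mul0r.
by move=> phi _; rewrite /= natrD mulrDl.
Qed.

Section BrauerIndependence.

Variables (p : nat) (M : modular_system p) (gT : finGroupType) (H : {group gT}).
Local Notation K := (fracK M).
Local Notation k := (resk M).

Hypothesis hK : exists z : K, #|H|.-primitive_root z.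

Lemma irr_repr_finite (F : fieldType) :
  exists m (t : 'I_m -> {n : nat & mx_representation F H n}),
    (forall i, mx_irreducible (tagged (t i))) /\
    forall n (rG : mx_representation F H n), mx_irreducible rG ->
      exists i, mx_rsim rG (tagged (t i)).
Proof.
have /asboolP[U [compU lastU]] : `[< exists U, exists compU : mx_composition_series (regular_repr F H) U,
    (last 0 U :=: 1%:M)%MS >].
  apply: (@mx_Schreier _ _ _ _ (regular_repr F H) [::]) => // -[U [compU lastU _]].
  by apply/asboolP; exists U, compU.
exists (size U), (fun i => Tagged _ (series_repr i compU)); split=> [i|n rG irrG] /=.
  exact: mx_series_repr_irr.
by have [i sim_i] := rsim_regular_series irrG compU lastU; exists i.
Qed.

Lemma IBr_finite : exists2 Phi : seq {ffun gT -> K}, uniq Phi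
  & forall phi, phi \in Phi <-> IBr M H phi.
Proof.
have [m [t [irr_t all_t]]] := irr_repr_finite k.
have /fin_all_exists[f fP] i := brauer_affords_exists hK (tagged (t i)).
exists (undup (codom f)) => [|phi]; first exact: undup_uniq.
rewrite mem_undup; split=> [/codomP[i ->] | [n [rH [irrH rHphi]]]].
  by exists (tag (t i)), (tagged (t i)).
have [i sim_i] := all_t _ _ irrH; apply/codomP; exists i.
exact: brauer_affords_rsim sim_i rHphi (fP i).
Qed.

(** There are at most as many irreducible Brauer characters as classes of
    [p']-elements, by [leq_irr_preg], and they span the functions on these
    classes, by [class_indicator_repr] and [decomposition]. *)
Lemma IBr_free (Phi : seq {ffun gT -> K}) (c : {ffun gT -> K} -> K) :
  uniq Phi -> (forall phi, phi \in Phi <-> IBr M H phi) ->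
  (forall s, s \in H -> (p^'.-elt s)%g -> \sum_(phi <- Phi) c phi * phi s = 0) ->
  forall phi, phi \in Phi -> c phi = 0.
Proof.
move=> uPhi PhiP c0; pose r := size Phi; pose f (i : 'I_r) := Phi`_i.
have /fin_all_exists[t tP] (i : 'I_r) : exists t : {n : nat & mx_representation k H n},
    mx_irreducible (tagged t) /\ brauer_affords (tagged t) (f i).
  have /PhiP[n [rH [irrH rHf]]] : f i \in Phi by rewrite mem_nth.
  by exists (Tagged _ rH).
have le_rC : (r <= #|preg_classes H p|)%N.
  apply: (leq_irr_preg (modular_pchar_res M) (rS := fun i => tagged (t i))) => [i|i j sim_ij].
    by have [] := tP i.
  have [_ ti] := tP i; have [_ tj] := tP j.
  apply/val_inj/eqP; rewrite -(nth_uniq 0 (ltn_ord i) (ltn_ord j) uPhi); apply/eqP.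
  exact: (brauer_affords_rsim hK sim_ij ti tj).
pose C := preg_classes H p; pose g (l : 'I_#|C|) : gT := repr (enum_val l).
have gP l : [/\ g l \in H, (p^'.-elt (g l))%g & enum_val l = (g l ^: H)%g].
  have /imsetP[x] := enum_valP l; rewrite !inE => /andP[Hx p'x] Dx.
  have : g l \in (x ^: H)%g by rewrite /g Dx (mem_repr x) ?class_refl.
  case/imsetP => y Hy Dg; split.
  - by rewrite Dg groupJ.
  - by rewrite Dg p_eltJ.
  - by rewrite Dx Dg classGidl.
pose X : 'M[K]_(r, #|C|) := \matrix_(i, l) f i (g l).
have sum_f (L : seq {ffun gT -> K}) s : (forall psi, psi \in L -> IBr M H psi) ->
    \sum_(psi <- L) psi s = \sum_(i < r) (count_mem (f i) L)%:R * f i s.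
  move=> LP; rewrite (sum_count_mem (fun phi : {ffun gT -> K} => phi s) uPhi).
    by rewrite (big_nth 0) big_mkord.
  by move=> psi /LP/PhiP.
have fullX : row_full X.
  apply/row_fullP.
  have /fin_all_exists[b bP] (l : 'I_#|C|) : exists b : 'I_r -> K, forall s,
      s \in H -> (p^'.-elt s)%g ->
      \sum_i b i * f i s = (s \in (g l ^: H)%g)%:R.
    have [Hg _ _] := gP l; have [a prim_a] := elt_prim_root hK Hg.
    have [rho rhoP] := class_indicator_repr Hg prim_a.
    have /fin_all_exists2[L LP DL] (j : 'I_#[g l]%g) := decomposition hK (tagged (rho j)).
    have nzC : #|('C_H[g l])%g|%:R != 0 :> K.
      by have /pcharf0P -> := modular_pchar_frac M; rewrite -lt0n cardG_gt0.
    exists (fun i => #|('C_H[g l])%g|%:R^-1 *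
      \sum_(j < #[g l]%g) emb M a ^+ j * (count_mem (f i) (L j))%:R) => s Hs p's.
    transitivity (#|('C_H[g l])%g|%:R^-1 *
      \sum_(j < #[g l]%g) emb M a ^+ j * \tr (tagged (rho j) s)).
      rewrite mulr_sumr (eq_bigr (fun i => \sum_(j < #[g l]%g) #|('C_H[g l])%g|%:R^-1 *
          (emb M a ^+ j * ((count_mem (f i) (L j))%:R * f i s)))) => [|i _].
        rewrite exchange_big /=; apply: eq_bigr => j _; rewrite -!mulr_sumr.
        by rewrite DL // (sum_f _ _ (LP j)).
      rewrite -mulrA mulr_suml mulr_sumr; apply: eq_bigr => j _.
      by rewrite !mulrA.
    by rewrite rhoP //; case: ifP => _; rewrite ?mulr0 ?mulVf.
  exists (\matrix_(l, i) b l i); apply/matrixP => l l'; rewrite !mxE.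
  have [Hg p'g Dg] := gP l'; have [_ _ Dgl] := gP l.
  rewrite (eq_bigr (fun i => b l i * f i (g l'))) => [|i _]; last by rewrite !mxE.
  rewrite bP //; congr ((nat_of_bool _)%:R); rewrite -Dgl.
  apply/idP/eqP => [gl | ->]; last by rewrite Dg class_refl.
  apply: enum_val_inj; rewrite Dg; rewrite Dgl in gl *.
  by apply/esym/class_eqP.
(* [X] has rank [#|C|], and not more than [#|C|] rows. *)
have freeX : row_free X.
  rewrite /row_free eqn_leq rank_leq_row /=.
  by have /eqP -> := fullX.
pose u : 'rV[K]_r := \row_i c (f i).
have uX : u *m X = 0.
  apply/rowP => l; have [Hg p'g _] := gP l; rewrite !mxE.
  rewrite -[RHS](c0 (g l)) // (big_nth 0) big_mkord; apply: eq_bigr => i _.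
  by rewrite !mxE.
have u0 : u = 0 by apply: (row_free_inj freeX); rewrite uX mul0mx.
move=> phi /(nthP 0)[i lt_ir <-].
have := congr1 (fun w : 'rV_r => w 0 (Ordinal lt_ir)) u0.
by rewrite !mxE.
Qed.

End BrauerIndependence.

(** * Generalised decomposition numbers *)

Section GeneralisedDecomposition.

Variables (p : nat) (M : modular_system p) (gT : finGroupType) (G : {group gT}).
Local Notation K := (fracK M).

Variables (zeta : K) (prim_zeta : #|G|.-primitive_root zeta).

(* [xi] is a primitive root of unity of order [q], the [p]-part of [#|G|]. *)
Local Notation q := (partn #|G| p).
Local Notation xi := (zeta ^+ (#|G| %/ q)).

Lemma subg_prim_root (H : {group gT}) : H \subset G ->
  exists z : K, #|H|.-primitive_root z.
Proof.
move=> sHG; exists (zeta ^+ (#|G| %/ #|H|)).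
exact: (dvdn_prim_root prim_zeta (cardSg sHG)).
Qed.

Lemma cent1_prim_root (u : gT) : exists z : K, #|('C_G[u])%g|.-primitive_root z.
Proof. by apply: subg_prim_root; apply: subsetIl. Qed.

Lemma p_part_prim_root : q.-primitive_root xi.
Proof. exact: (dvdn_prim_root prim_zeta (dvdn_part _ _)). Qed.

(** As [u] is central in its centraliser, its eigenspaces are representations of
    the centraliser; they are decomposed separately. *)
Lemma repr_decomposition_poly (u : gT) (Phi : seq {ffun gT -> K}) n
    (rV : mx_representation K G n) :
  u \in G -> (p.-elt u)%g -> uniq Phi -> (forall phi, phi \in Phi <-> IBr M 'C_G[u]%G phi) ->
  exists Q : {ffun gT -> K} -> {poly int}, forall s, s \in 'C_G[u]%g -> (p^'.-elt s)%g ->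
    \tr (rV (u * s)%g) = \sum_(phi <- Phi) (map_poly intr (Q phi)).[xi] * phi s.
Proof.
move=> Gu pu uPhi PhiP; pose H := 'C_G[u]%G.
have sHG : H \subset G by apply: subsetIl.
have uq : (u ^+ q = 1)%g.
  apply/eqP; rewrite -order_dvdn -(part_pnat_id (_ : p.-nat #[u]%g)) //.
  exact: partn_dvd (order_dvdG Gu).
have rX i : rV u ^+ i = rV (u ^+ i)%g.
  elim: i => [|i IHi]; first by rewrite expg0 repr_mx1.
  by rewrite exprS IHi expgS repr_mxM ?groupX.
have Aq : rV u ^+ q = 1 by rewrite rX uq repr_mx1.
have cA s : s \in H -> rV u *m subg_repr rV sHG s = subg_repr rV sHG s *m rV u.
  by case/setIP => Gs /cent1P cus /=; rewrite -!repr_mxM // cus.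
have [rho rhoP] := eigen_repr p_part_prim_root Aq cA.
have /fin_all_exists2[L LP DL] (j : 'I_q) := decomposition (cent1_prim_root u) (tagged (rho j)).
exists (fun phi => \sum_(j < q) (count_mem phi (L j))%:R *: 'X^j) => s Hs p's.
have Gs : s \in G by case/setIP: Hs.
rewrite repr_mxM // (rhoP s Hs).
rewrite (eq_bigr (fun j : 'I_q => \sum_(phi <- Phi) xi ^+ j * ((count_mem phi (L j))%:R * phi s))).
  rewrite exchange_big /=; apply: eq_bigr => phi _.
  rewrite rmorph_sum /= horner_sum mulr_suml; apply: eq_bigr => j _.
  by rewrite map_polyZ /= map_polyXn hornerZ hornerXn rmorph_nat mulrA [_ * xi ^+ _]mulrC.
move=> j _; rewrite DL // (sum_count_mem (fun phi : {ffun gT -> K} => phi s) uPhi) ?mulr_sumr //.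
by move=> psi /LP/PhiP.
Qed.

Variables (chi : {ffun gT -> K}) (hchi : ZIrr G chi).

(** The existence of generalised decomposition numbers, as integral polynomials
    in a root of unity of [p]-power order. *)
Lemma gen_decomposition_poly (u : gT) (Phi : seq {ffun gT -> K}) :
  u \in G -> (p.-elt u)%g -> uniq Phi -> (forall phi, phi \in Phi <-> IBr M 'C_G[u]%G phi) ->
  exists Q : {ffun gT -> K} -> {poly int}, forall s, s \in 'C_G[u]%g -> (p^'.-elt s)%g ->
    chi (u * s)%g = \sum_(phi <- Phi) (map_poly intr (Q phi)).[xi] * phi s.
Proof.
move=> Gu pu uPhi PhiP; have [n [c [psi [irr_psi ->]]]] := hchi.
have /fin_all_exists[Q QP] (i : 'I_n) : exists Q : {ffun gT -> K} -> {poly int},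
    forall s, s \in 'C_G[u]%g -> (p^'.-elt s)%g ->
      psi i (u * s)%g = \sum_(phi <- Phi) (map_poly intr (Q phi)).[xi] * phi s.
  have [m [rV [_ psiV]]] := irr_psi i.
  have [Q QP] := repr_decomposition_poly rV Gu pu uPhi PhiP.
  exists Q => s Hs p's; rewrite psiV groupM ?QP //.
  by case/setIP: Hs.
exists (fun phi => \sum_(i < n) Q i phi *~ c i) => s Hs p's.
rewrite sum_ffunE.
rewrite (eq_bigr (fun i : 'I_n => \sum_(phi <- Phi) ((map_poly intr (Q i phi)).[xi] *~ c i) * phi s)).
  rewrite exchange_big /=; apply: eq_bigr => phi _; rewrite -mulr_suml; congr (_ * _).
  rewrite rmorph_sum /= horner_sum; apply: eq_bigr => i _.
  by rewrite raddfMz -[RHS]horner_evalE raddfMz.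
move=> i _; rewrite ffunMzE QP // mulrz_suml; apply: eq_bigr => phi _.
by rewrite -mulrzAl.
Qed.

Lemma IBr_fsum (H : {group gT}) (Phi : seq {ffun gT -> K}) (F : {ffun gT -> K} -> K) :
  uniq Phi -> (forall phi, phi \in Phi <-> IBr M H phi) ->
  \sum_(phi \in IBr M H) F phi = \sum_(phi <- Phi) F phi.
Proof.
move=> uPhi PhiP; rewrite [RHS]fsbig_seq //.
have -> : IBr M H = [set` Phi] by rewrite predeqE => phi; rewrite -PhiP.
by [].
Qed.

(** By linear independence, the generalised decomposition numbers are the
    coefficients of every expansion of [chi (u * s)] in the irreducible Brauer
    characters. *)
Lemma gen_decomposition_number_unique (u : gT) (Phi : seq {ffun gT -> K})
    (d : {ffun gT -> K} -> K) phi :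
  uniq Phi -> (forall phi, phi \in Phi <-> IBr M 'C_G[u]%G phi) ->
  is_gen_decomposition G chi u d -> phi \in Phi ->
  gen_decomposition_number G chi u phi = d phi.
Proof.
move=> uPhi PhiP dec_d Phiphi; apply: xget_unique => [|_ [d' [[_ dec_d'] ->]]].
  by exists d.
have [_ dec] := dec_d; apply/eqP; rewrite -subr_eq0; apply/eqP.
apply: (IBr_free (cent1_prim_root u) (c := fun psi => d' psi - d psi) uPhi PhiP) => // s Hs p's.
rewrite (eq_bigr (fun psi => d' psi * psi s - d psi * psi s)) => [|psi _]; last by rewrite mulrBl.
rewrite sumrB -(IBr_fsum (fun psi => d' psi * psi s) uPhi PhiP).
by rewrite -(IBr_fsum (fun psi => d psi * psi s) uPhi PhiP) -dec // -dec_d' // subrr.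
Qed.

(** The generalised decomposition numbers lie in [Q(xi)] and decompose [chi]. *)
Lemma gen_decomposition_numberP (u : gT) (Phi : seq {ffun gT -> K}) :
  u \in G -> (p.-elt u)%g -> uniq Phi -> (forall phi, phi \in Phi <-> IBr M 'C_G[u]%G phi) ->
  (forall phi, phi \in Phi -> exists r : {poly rat},
     gen_decomposition_number G chi u phi = (map_poly ratr r).[xi]) /\
  (forall s, s \in 'C_G[u]%g -> (p^'.-elt s)%g ->
     chi (u * s)%g = \sum_(phi <- Phi) gen_decomposition_number G chi u phi * phi s).
Proof.
move=> Gu pu uPhi PhiP; have [Q QP] := gen_decomposition_poly Gu pu uPhi PhiP.
pose d phi : K := (map_poly intr (Q phi)).[xi].
have dec_d : is_gen_decomposition G chi u d.
  split=> [phi _|s Hs p's]; last by rewrite (IBr_fsum _ uPhi PhiP) QP.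
  by exists q, K, idfun, xi, (Q phi); split=> //; apply: p_part_prim_root.
have dE phi : phi \in Phi -> gen_decomposition_number G chi u phi = d phi.
  exact: gen_decomposition_number_unique.
split=> [phi /dE ->|s Hs p's].
  have [f fE] := rat_morphism (modular_pchar_frac M).
  exists (map_poly intr (Q phi)); rewrite /d -(eq_map_poly fE) -map_poly_comp.
  by congr _.[_]; apply: eq_map_poly => a /=; rewrite rmorph_int.
by rewrite QP //; apply: eq_big_seq => phi /dE ->.
Qed.

(** Brauer characters have their values in [Q(zeta_m)], for [m] the [p']-part of
    [#|G|]. *)
Lemma brauer_value_poly (H : {group gT}) (phi : {ffun gT -> K}) s :
  H \subset G -> IBr M H phi -> s \in H -> (p^'.-elt s)%g ->
  exists r : {poly rat}, phi s = (map_poly ratr r).[zeta ^+ (#|G| %/ (partn #|G| p^'))].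
Proof.
move=> sHG [n [rH [_ [rHphi _]]]] Hs p's; have [l [l1 _ ->]] := rHphi s Hs p's.
have K0 := modular_pchar_frac M; have [f fE] := rat_morphism K0.
set z := zeta ^+ _; have prim_z : (partn #|G| p^').-primitive_root z.
  exact: (dvdn_prim_root prim_zeta (dvdn_part _ _)).
have dv_s : (#[s]%g %| partn #|G| p^')%N.
  by rewrite -(part_pnat_id p's) partn_dvd // order_dvdG // (fintype.subsetP sHG).
elim: l l1 => [|a l IHl] l1; first by exists 0; rewrite big_nil -(eq_map_poly fE) rmorph0 horner0.
have [|r Dr] := IHl; first by move=> b lb; rewrite l1 // inE lb orbT.
have am : emb M a ^+ (partn #|G| p^') = 1.
  have [c ->] := dvdnP dv_s; rewrite mulnC exprM -rmorphXn l1 ?mem_head //.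
  by rewrite rmorph1 expr1n.
have [i Da] := prim_rootP prim_z am.
exists ('X^i + r); rewrite big_cons Dr Da -!(eq_map_poly fE) rmorphD /= map_polyXn.
by rewrite hornerD hornerXn.
Qed.

End GeneralisedDecomposition.

(** * Conductors of characters and of generalised decomposition numbers *)

Section Conductors.

Variables (p : nat) (M : modular_system p) (gT : finGroupType) (G : {group gT}).
Local Notation K := (fracK M).

Variables (zeta : K) (prim_zeta : #|G|.-primitive_root zeta).
Variables (chi : {ffun gT -> K}) (hchi : ZIrr G chi).

Local Notation q := (partn #|G| p).
Local Notation m := (partn #|G| p^').
Local Notation values := [set x : K | exists2 g : gT, g \in G & x = chi g].
Local Notation dnum := (gen_decomposition_number G chi).

Let K0 := modular_pchar_frac M.

Lemma dnum_cyclotomic u phi : u \in G -> (p.-elt u)%g -> IBr M 'C_G[u]%G phi ->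
  in_cyclotomic q [set dnum u phi].
Proof.
move=> Gu pu Hphi; have [Phi uPhi PhiP] := IBr_finite (cent1_prim_root prim_zeta u).
have [dP _] := gen_decomposition_numberP prim_zeta hchi Gu pu uPhi PhiP.
exists K, idfun, (zeta ^+ (#|G| %/ q)); split; first exact: p_part_prim_root.
by move=> _ ->; apply: dP; apply/PhiP.
Qed.

(** The values of [chi] lie in [Q(zeta_(m * e))] if and only if all the
    generalised decomposition numbers lie in [Q(zeta_e)]. Brauer characters have
    their values in [Q(zeta_m)]. If the values of [chi] lie in [Q(zeta_(m * e))],
    an automorphism over this field fixes the generalised decomposition numbers,
    by uniqueness, so that these lie in the intersection [Q(zeta_e)] of
    [Q(zeta_(m * e))] and [Q(zeta_q)]. *)
Lemma values_cyclotomicP (e : nat) : (e %| q)%N ->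
  in_cyclotomic (m * e) values <->
  (forall u phi, u \in G -> (p.-elt u)%g -> IBr M 'C_G[u]%G phi ->
     in_cyclotomic e [set dnum u phi]).
Proof.
move=> dv_eq; have n_gt0 := prim_order_gt0 prim_zeta.
have [Q] := cyclotomic_field_exists n_gt0.
have [h hgen] := cyclotomic_embedding Q K0 prim_zeta.
have hroot d : h (cyc_root Q d) = zeta ^+ (#|G| %/ d) by rewrite rmorphXn /= hgen.
have dv_m : (m %| #|G|)%N := dvdn_part _ _.
have dv_q : (q %| #|G|)%N := dvdn_part _ _.
have Dn : (m * q = #|G|)%N by rewrite mulnC partnC.
have dv_e : (e %| #|G|)%N := dvdn_trans dv_eq dv_q.
have dv_me : (m * e %| #|G|)%N by rewrite -[X in (_ %| X)%N]Dn dvdn_mul.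
have hpoly d (r : {poly rat}) : exists2 y, y \in cyc_sub Q d
    & h y = (map_poly ratr r).[zeta ^+ (#|G| %/ d)].
  exists (map_poly ratr r).[cyc_root Q d]; first by apply/cyc_sub_ratrP; exists r.
  by rewrite map_poly_ratrE hroot.
have phi_val u phi s : IBr M 'C_G[u]%G phi -> s \in 'C_G[u]%g -> (p^'.-elt s)%g ->
    exists2 y, y \in cyc_sub Q (m * e) & phi s = h y.
  move=> Hphi Hs p's.
  have [r Dr] := brauer_value_poly prim_zeta (subsetIl _ _) Hphi Hs p's.
  have [y my hy] := hpoly m r; exists y; last by rewrite hy.
  by apply: subvP my; apply: cyc_subS; rewrite ?dvdn_mulr.
split=> [/(in_cyclotomicP h _ K0 dv_me) valsP u phi Gu pu Hphi | dP].
  have [Phi uPhi PhiP] := IBr_finite (cent1_prim_root prim_zeta u).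
  have [dpoly dec] := gen_decomposition_numberP prim_zeta hchi Gu pu uPhi PhiP.
  apply/(in_cyclotomicP h _ K0 dv_e) => _ ->.
  have dlt_ex psi : exists y : Q, psi \in Phi -> y \in cyc_sub Q q /\ dnum u psi = h y.
    have [/dpoly[r Dr]|] := boolP (psi \in Phi); last by exists 0.
    by have [y qy hy] := hpoly q r; exists y; rewrite Dr hy.
  pose dlt psi := sval (cid (dlt_ex psi)).
  have dltP psi : psi \in Phi -> dlt psi \in cyc_sub Q q /\ dnum u psi = h (dlt psi).
    by rewrite /dlt; case: cid.
  have Phiphi : phi \in Phi by apply/PhiP.
  have [dlt_q ->] := dltP phi Phiphi; exists (dlt phi) => //.
  suffices dlt_me : dlt phi \in cyc_sub Q (m * e).
    have -> : e = gcdn (m * e) q.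
      by rewrite gcdnC Gauss_gcdr ?(gcdn_idPr dv_eq) ?coprime_partC.
    exact: cyc_sub_cap.
  (* [dlt psi] is the preimage of the decomposition number at [psi]; its conjugates
     under [s] decompose [chi] as well. *)
  apply: cyc_sub_fixed => s fix_s; apply: (fmorph_inj h).
  apply/eqP; rewrite -subr_eq0; apply/eqP.
  apply: (IBr_free (cent1_prim_root prim_zeta u) (c := fun psi => h (s (dlt psi)) - h (dlt psi)) uPhi PhiP) => // t Ht p't.
  have Gut : (u * t)%g \in G by rewrite groupM //; case/setIP: Ht.
  have [x x_me Dx] : exists2 x, x \in cyc_sub Q (m * e) & chi (u * t)%g = h x.
    by apply: valsP; exists (u * t)%g.
  have val_ex psi : exists y : Q, psi \in Phi -> y \in cyc_sub Q (m * e) /\ psi t = h y.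
    have [/PhiP Hpsi|] := boolP (psi \in Phi); last by exists 0.
    by have [y ? ?] := phi_val u psi t Hpsi Ht p't; exists y.
  pose val psi := sval (cid (val_ex psi)).
  have valP psi : psi \in Phi -> val psi \in cyc_sub Q (m * e) /\ psi t = h (val psi).
    by rewrite /val; case: cid.
  have Dx' : x = \sum_(psi <- Phi) dlt psi * val psi.
    apply: (fmorph_inj h); rewrite -Dx dec // rmorph_sum /=.
    by apply: eq_big_seq => psi Phipsi; rewrite rmorphM; have [_ ->] := dltP psi Phipsi; have [_ ->] := valP psi Phipsi.
  have sx : s x = \sum_(psi <- Phi) s (dlt psi) * val psi.
    rewrite [in LHS]Dx' rmorph_sum /=; apply: eq_big_seq => psi Phipsi.
    by rewrite rmorphM [s (val psi)]fix_s //; have [] := valP psi Phipsi.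
  rewrite (eq_big_seq (fun psi => h (s (dlt psi) * val psi) - h (dlt psi * val psi))).
    by rewrite sumrB -!rmorph_sum -sx -Dx' fix_s // subrr.
  by move=> psi Phipsi; have [_ ->] := valP psi Phipsi; rewrite mulrBl !rmorphM.
apply/(in_cyclotomicP h _ K0 dv_me) => _ [g Gg ->].
pose u := (g.`_p)%g; pose s := (g.`_p^')%g.
have Gu : u \in G by rewrite groupX.
have pu : (p.-elt u)%g by exact: p_elt_constt.
have Hs : s \in 'C_G[u]%g.
  by rewrite finset.inE groupX //=; apply/cent1P; apply: commuteX2.
have [Phi uPhi PhiP] := IBr_finite (cent1_prim_root prim_zeta u).
have [_ dec] := gen_decomposition_numberP prim_zeta hchi Gu pu uPhi PhiP.
rewrite -(consttC p g) dec ?p_elt_constt // big_seq.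
elim/big_ind: _ => [|_ _ [y1 y1P ->] [y2 y2P ->]|phi /PhiP Hphi].
- by exists 0; rewrite ?rmorph0 ?mem0v.
- by exists (y1 + y2); rewrite ?rmorphD ?memvD.
have [y1 y1P ->] := proj1 (in_cyclotomicP h _ K0 dv_e) (dP u phi Gu pu Hphi) _ erefl.
have [y2 y2P ->] := phi_val u phi s Hphi Hs (p_elt_constt _ _).
exists (y1 * y2); last by rewrite rmorphM.
apply: rpredM => //; apply: subvP y1P; apply: cyc_subS => //; exact: dvdn_mull.
Qed.

Lemma values_in_cyclotomic : in_cyclotomic #|G| values.
Proof.
have -> : #|G| = (m * q)%N by rewrite mulnC partnC.
by apply/values_cyclotomicP => // u phi; apply: dnum_cyclotomic.
Qed.

Lemma IBr_nonempty (H : {group gT}) : H \subset G -> exists phi, IBr M H phi.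
Proof.
move=> sHG; have rep1 : mx_repr H (fun _ : gT => 1%:M : 'M[resk M]_1).
  by split=> // x y _ _; rewrite mulmx1.
have [phi Hphi] := brauer_affords_exists (subg_prim_root prim_zeta sHG) (MxRepresentation rep1).
exists phi, 1%N, (MxRepresentation rep1); split=> //.
by apply/mx_abs_irrW/linear_mx_abs_irr.
Qed.

End Conductors.

Theorem corollary1p2 (p : nat) (M : modular_system p)
    (gT : finGroupType) (G : {group gT})
    (hK : exists z : fracK M, #|G|.-primitive_root z)
    (chi : {ffun gT -> fracK M}) (hchi : ZIrr G chi) :
  exists (u : gT) (phi : {ffun gT -> fracK M}),
    [/\ u \in G, (p.-elt u)%g & IBr M 'C_G[u]%G phi] /\
    (((char_conductor G chi)`_p)%N =
       conductor [set gen_decomposition_number G chi u phi] /\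
     forall (v : gT) (psi : {ffun gT -> fracK M}),
       v \in G -> (p.-elt v)%g -> IBr M 'C_G[v]%G psi ->
       (conductor [set gen_decomposition_number G chi v psi]
          <= (char_conductor G chi)`_p)%N).
Proof.
have [zeta prim_zeta] := hK; have K0 := modular_pchar_frac M.
have n_gt0 := prim_order_gt0 prim_zeta.
have [c_in c_min] := conductorP K0 prim_zeta (values_in_cyclotomic prim_zeta hchi).
rewrite -/(char_conductor G chi) in c_in c_min; set c := char_conductor G chi in c_in c_min *.
have dv_cn : (c %| #|G|)%N by apply: c_min; apply: (values_in_cyclotomic prim_zeta hchi).
have c_gt0 : (c > 0)%N := dvdn_gt0 n_gt0 dv_cn.
set e := (c`_p)%N; pose q := partn #|G| p; pose m := partn #|G| p^'.
have dv_eq : (e %| q)%N by apply: partn_dvd.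
have e_gt0 : (e > 0)%N by apply: part_gt0.
have dv_cme : (c %| m * e)%N.
  by rewrite -(partnC p c_gt0) mulnC dvdn_mul // partn_dvd.
have dv_men : (m * e %| #|G|)%N.
  by rewrite -[X in (_ %| X)%N](partnC p n_gt0) mulnC dvdn_mul.
have d_in : forall v psi, v \in G -> (p.-elt v)%g -> IBr M 'C_G[v]%G psi ->
    in_cyclotomic e [set gen_decomposition_number G chi v psi].
  apply/(values_cyclotomicP prim_zeta hchi dv_eq).
  exact: in_cyclotomicS K0 prim_zeta dv_cme dv_men c_in.
have d_cond v psi : v \in G -> (p.-elt v)%g -> IBr M 'C_G[v]%G psi ->
    (conductor [set gen_decomposition_number G chi v psi] %| e)%N.
  move=> Gv pv Hpsi; have prim_q := p_part_prim_root prim_zeta.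
  have [_ d_min] := conductorP K0 prim_q (dnum_cyclotomic prim_zeta hchi Gv pv Hpsi).
  exact/d_min/d_in.
have [[u [phi [Hu Dd]]] | noud] := pselect (exists u phi,
    [/\ u \in G, (p.-elt u)%g & IBr M 'C_G[u]%G phi] /\
    e = conductor [set gen_decomposition_number G chi u phi]).
  exists u, phi; split=> //; split=> // v psi Gv pv Hpsi.
  by apply: dvdn_leq => //; apply: d_cond.
(* Otherwise all these conductors are proper divisors of the power [e] of [p], so
   that the generalised decomposition numbers lie in [Q(zeta_(e / p))] and the
   values of [chi] in [Q(zeta_(m * (e / p)))], against the minimality of [c]. For
   [e = 1], the contradiction comes from any irreducible Brauer character. *)
have p_pr := modular_prime M.
have [b De] : exists b, e = (p ^ b)%N by exists (logn p c); rewrite /e p_part.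
case: b De => [|b] De.
  have [phi Hphi] := IBr_nonempty prim_zeta (subsetIl G 'C[1]%g : 'C_G[1]%G \subset G).
  case: noud; exists 1%g, phi; split; first by rewrite group1 p_elt1.
  have := d_cond 1%g phi (group1 G) (p_elt1 _ _) Hphi.
  by rewrite De expn0 dvdn1 => /eqP.
have dv_bq : (p ^ b %| q)%N by apply: dvdn_trans dv_eq; rewrite De dvdn_exp2l.
have : in_cyclotomic (m * p ^ b) [set x | exists2 g, g \in G & x = chi g].
  apply/(values_cyclotomicP prim_zeta hchi dv_bq) => v psi Gv pv Hpsi.
  have [d_c d_min] := conductorP K0 (p_part_prim_root prim_zeta)
    (dnum_cyclotomic prim_zeta hchi Gv pv Hpsi).
  have := d_cond v psi Gv pv Hpsi; rewrite De => /(dvdn_pfactor _ _ p_pr)[j le_jb Dj].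
  have [lt_jb | le_bj] := leqP j b.
    have dv_bn : (p ^ b %| #|G|)%N := dvdn_trans dv_bq (dvdn_part _ _).
    by apply: (in_cyclotomicS K0 prim_zeta _ dv_bn d_c); rewrite Dj dvdn_exp2l.
  case: noud; exists v, psi; split=> //.
  by rewrite Dj De; congr (_ ^ _)%N; apply/eqP; rewrite eqn_leq le_jb le_bj.
move/c_min/(partn_dvd p); rewrite muln_gt0 part_gt0 expn_gt0 prime_gt0 // => /(_ isT).
rewrite -/e De partnM ?part_gt0 ?expn_gt0 ?prime_gt0 // [((p ^ b)`_p)%N]part_pnat_id ?pnatX ?pnat_id //.
have -> : partn m p = 1%N by rewrite part_p'nat // part_pnat.
by rewrite mul1n dvdn_Pexp2l ?prime_gt1 // ltnn.
Qed.
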